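(* Let $(M,g,(J_{\alpha}),\nabla)$ be a 4-dimensional QKT manifold with torsion 1-form $t$. The following conditions are equivalent: (i) $(M,g,(J_{\alpha}),\nabla)$ is a sp(1)-Einstein QKT manifold. (ii) The corresponding Weyl structure $\nabla^W$, i.e. the unique torsion-free linear connection determined by $\nabla^Wg=-t\otimes g$, is an Einstein-Weyl structure.
   Context: An almost quaternionic structure on a $4n$-dimensional manifold $M$ is a rank-3 subbundle $Q\subset \mathrm{End}(TM)$ locally spanned by triples $(J_1,J_2,J_3)$ of almost complex structures with $J_\alpha^2=-\mathrm{id}$, $J_1J_2=-J_2J_1=J_3$ (admissible bases, locally defined). A linear connection is quaternionic if it preserves $Q$. A Riemannian metric $g$ is $Q$-hermitian if it is Hermitian with respect to each almost complex structure in $Q$. $(\alpha,\beta,\gamma)$ is a cyclic permutation of $(1,2,3)$. For a connection $\nabla$, $T(X,Y)=\nabla_XY-\nabla_YX-[X,Y]$ and $T(X,Y,Z)=g(T(X,Y),Z)$. An almost quaternionic manifold with $Q$-hermitian metric is a QKT manifold if it is endowed with a metric quaternionic connection $\nabla$ whose torsion is totally skew-symmetric and of type $(1,2)+(2,1)$ with respect to each $J_\alpha$, i.e. $T(X,Y,Z)=T(J_\alpha X,J_\alpha Y,Z)+T(J_\alpha X,Y,J_\alpha Z)+T(X,J_\alpha Y,J_\alpha Z)$. For an $r$-form $\psi$, $(J_\alpha\psi)(X_1,\dots,X_r)=(-1)^r\psi(J_\alpha X_1,\dots,J_\alpha X_r)$. With $t_\alpha(X)=-\frac12\sum_{i}T(X,e_i,J_\alpha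 e_i)$, $(e_i)$ orthonormal, the 1-form $t=J_\alpha t_\alpha$ is independent of $\alpha$ and is called the torsion 1-form. In dimension 4, $T=*t$ ($*$ the Hodge operator) and $\nabla=\nabla^g+\frac12T$. Curvature: $R(X,Y)=[\nabla_X,\nabla_Y]-\nabla_{[X,Y]}$, $R(X,Y,Z,V)=g(R(X,Y)Z,V)$; Ricci forms $\rho_\alpha(X,Y)=\frac12\sum_iR(X,Y,e_i,J_\alpha e_i)$. Put $K(X,Y)=\rho_\alpha(X,J_\alpha Y)+\rho_\beta(X,J_\beta Y)+\rho_\gamma(X,J_\gamma Y)$, which is independent of the admissible basis. A 4-dimensional QKT manifold is sp(1)-Einstein if the symmetric part of $K$ is a scalar (function) multiple of $g$: $\mathrm{Sym}(K)=\frac{\mathrm{tr}_gK}{4}g$. A Weyl structure is Einstein-Weyl if the symmetric part of its Ricci tensor is a scalar (function) multiple of $g$. *)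

(* Defs.v *)
From HB Require Import structures.
From mathcomp Require Import all_boot all_order all_algebra.
From mathcomp Require Import all_classical all_reals all_analysis.
Set Implicit Arguments.
Unset Strict Implicit.
Unset Printing Implicit Defensive.
Import Order.TTheory GRing.Theory Num.Theory numFieldNormedType.Exports.
Local Open Scope classical_set_scope.
Local Open Scope ring_scope.

(* A smooth manifold is given by an atlas, and geometric objects (tensor      *)
(* fields, connections) by their coordinate expressions in the charts of the  *)
(* atlas, subject to the usual change of coordinates.  Tangent vectors are    *)
(* columns, endomorphisms of the tangent space act on them on the left,       *)
(* 1-forms are rows.  Values of coordinate expressions outside the image of a *)
(* chart, or in charts that do not belong to the atlas, are irrelevant.       *)

(* C^k, for functions on an open set U: differentiable, with all directional  *)
(* derivatives of class C^(k-1).                                              *)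
Fixpoint Ck_on (R : realType) (V W : normedModType R) (k : nat)
    (U : set V) (f : V -> W) {struct k} : Prop :=
  match k with
  | 0%N => forall x, U x -> {for x, continuous f}
  | k'.+1 => (forall x, U x -> differentiable f x) /\
             (forall v : V, Ck_on k' U (fun x => 'D_v f x))
  end.

Definition smooth_on (R : realType) (V W : normedModType R) (U : set V)
    (f : V -> W) : Prop :=
  forall k, Ck_on k U f.

Notation coord R := 'cV[R]_4.

Record chart (R : realType) (M : topologicalType) := Chart {
  dom : set M;
  phi : M -> coord R;
  psi : coord R -> M;
  dom_open : open dom;
  img_open : open (phi @` dom);
  phiK : forall p, dom p -> psi (phi p) = p;
  phi_continuous : forall p, dom p -> {for p, continuous phi};
  psi_continuous : forall x, (phi @` dom) x -> {for x, continuous psi} }.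

Definition img (R : realType) (M : topologicalType) (c : chart R M) :
  set (coord R) := phi c @` dom c.

Definition trans (R : realType) (M : topologicalType) (c d : chart R M) :
  coord R -> coord R := fun x => phi d (psi c x).

Definition overlap (R : realType) (M : topologicalType) (c d : chart R M) :
  set (coord R) := [set x | img c x /\ dom d (psi c x)].

Record manifold4 (R : realType) := Manifold4 {
  points :> topologicalType;
  atlas : set (chart R points);
  points_hausdorff : hausdorff_space points;
  points_countable : @second_countable points;
  atlas_cover : forall p : points, exists2 c, atlas c & dom c p;
  atlas_smooth : forall c d, atlas c -> atlas d ->
    smooth_on (overlap c d) (trans c d) }.

Definition vfield (R : realType) := coord R -> coord R.

Definition bracket (R : realType) (X Y : vfield R) : vfield R :=
  fun x => 'D_(X x) Y x - 'D_(Y x) X x.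

Definition gamma_of (R : realType) (G : 'I_4 -> coord R -> 'M[R]_4)
  (x u : coord R) : 'M[R]_4 := \sum_(i < 4) u i 0 *: G i x.

(* In each chart, nabla_(d/dx^i) Y = dY/dx^i + christoffel c i *m Y.  The last *)
(* field is the transformation law of Christoffel symbols under tau, i.e.     *)
(* d tau (Gamma(u, v)) = d^2 tau (u, v) + Gamma'(d tau u, d tau v).           *)
Record connection (R : realType) (M : manifold4 R) := Connection {
  christoffel : chart R M -> 'I_4 -> coord R -> 'M[R]_4;
  christoffel_smooth : forall c i, atlas c ->
    smooth_on (img c) (christoffel c i);
  christoffel_trans : forall c d, atlas c -> atlas d ->
    forall x, overlap c d x -> forall u v : coord R,
    let tau := trans c d in
    'D_(gamma_of (christoffel c) x u *m v) tau x =
    'D_u (fun y => 'D_v tau y) x +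
    gamma_of (christoffel d) (tau x) ('D_u tau x) *m 'D_v tau x }.

Definition gamma (R : realType) (M : manifold4 R) (N : connection M)
    (c : chart R M) : coord R -> coord R -> 'M[R]_4 :=
  gamma_of (christoffel N c).

Definition cov (R : realType) (M : manifold4 R) (N : connection M)
    (c : chart R M) (X Y : vfield R) : vfield R :=
  fun x => 'D_(X x) Y x + gamma N c x (X x) *m Y x.

(* (nabla_u A) for a field of endomorphisms A, i.e.                           *)
(* Y |-> nabla_u (A Y) - A (nabla_u Y).                                       *)
Definition covEnd (R : realType) (M : manifold4 R) (N : connection M)
    (c : chart R M) (A : coord R -> 'M[R]_4) (x u : coord R) : 'M[R]_4 :=
  'D_u A x + gamma N c x u *m A x - A x *m gamma N c x u.

Definition torsion_field (R : realType) (M : manifold4 R) (N : connection M)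
    (c : chart R M) (X Y : vfield R) : vfield R :=
  fun x => cov N c X Y x - cov N c Y X x - bracket X Y x.

Definition curvature_field (R : realType) (M : manifold4 R)
    (N : connection M) (c : chart R M) (X Y Z : vfield R) : vfield R :=
  fun x => cov N c X (cov N c Y Z) x - cov N c Y (cov N c X Z) x
           - cov N c (bracket X Y) Z x.

(* Torsion and curvature are tensorial; their values on tangent vectors at x  *)
(* are computed by extending these to fields constant in the chart.           *)
Definition torsion (R : realType) (M : manifold4 R) (N : connection M)
    (c : chart R M) (x u v : coord R) : coord R :=
  torsion_field N c (cst u) (cst v) x.

Definition curvature (R : realType) (M : manifold4 R) (N : connection M)
    (c : chart R M) (x u v w : coord R) : coord R :=
  curvature_field N c (cst u) (cst v) (cst w) x.

Record riem_metric (R : realType) (M : manifold4 R) := RiemMetric {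
  gram : chart R M -> coord R -> 'M[R]_4;
  gram_smooth : forall c, atlas c -> smooth_on (img c) (gram c);
  gram_sym : forall c x, atlas c -> img c x -> (gram c x)^T = gram c x;
  gram_pos : forall c x (u : coord R), atlas c -> img c x -> u != 0 ->
    0 < (u^T *m gram c x *m u) 0 0;
  gram_trans : forall c d, atlas c -> atlas d ->
    forall x, overlap c d x -> forall u v : coord R,
    let tau := trans c d in
    (u^T *m gram c x *m v) 0 0 =
    (('D_u tau x)^T *m gram d (tau x) *m 'D_v tau x) 0 0 }.

Definition gdot (R : realType) (M : manifold4 R) (g : riem_metric M)
    (c : chart R M) (x u v : coord R) : R :=
  (u^T *m gram g c x *m v) 0 0.

Definition orthonormal (R : realType) (M : manifold4 R) (g : riem_metric M)
    (c : chart R M) (x : coord R) (e : 'I_4 -> coord R) : Prop :=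
  forall i j, gdot g c x (e i) (e j) = (i == j)%:R.

Record oneform (R : realType) (M : manifold4 R) := OneForm {
  covec : chart R M -> coord R -> 'rV[R]_4;
  covec_smooth : forall c, atlas c -> smooth_on (img c) (covec c);
  covec_trans : forall c d, atlas c -> atlas d ->
    forall x, overlap c d x -> forall u : coord R,
    let tau := trans c d in
    (covec c x *m u) 0 0 = (covec d (tau x) *m 'D_u tau x) 0 0 }.

Definition oneform_at (R : realType) (M : manifold4 R) (t : oneform M)
    (c : chart R M) (x u : coord R) : R := (covec t c x *m u) 0 0.

(* (nabla_u g)(v, w) *)
Definition cov_metric (R : realType) (M : manifold4 R) (N : connection M)
    (g : riem_metric M) (c : chart R M) (x u v w : coord R) : R :=
  'D_u (fun y => gdot g c y v w) x
  - gdot g c x (cov N c (cst u) (cst v) x) w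
  - gdot g c x v (cov N c (cst u) (cst w) x).

(* The indices 0, 1, 2 : 'I_3 stand for 1, 2, 3. *)
Definition quaternionic_triple (R : realType) (J : 'I_3 -> 'M[R]_4) : Prop :=
  [/\ forall a, J a *m J a = - 1%:M,
      J 0 *m J 1 = J 2 & J 1 *m J 0 = - J 2].

Definition span3 (R : realType) (J : 'I_3 -> 'M[R]_4) : set 'M[R]_4 :=
  [set A | exists a : 'I_3 -> R, A = \sum_(i < 3) a i *: J i].

(* J is an admissible basis, on the open subset U of the image of c, of the   *)
(* family of sets of endomorphisms F.                                         *)
Definition admissible (R : realType) (M : manifold4 R) (c : chart R M)
    (F : coord R -> set 'M[R]_4) (U : set (coord R))
    (J : 'I_3 -> coord R -> 'M[R]_4) : Prop :=
  [/\ open U, U `<=` img c, forall a, smooth_on U (J a) &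
      forall x, U x ->
        quaternionic_triple (J ^~ x) /\ F x = span3 (J ^~ x)].

Record almost_quaternionic (R : realType) (M : manifold4 R) :=
  AlmostQuaternionic {
  fiber : chart R M -> coord R -> set 'M[R]_4;
  fiber_local : forall c x, atlas c -> img c x ->
    exists U J, U x /\ admissible c (fiber c) U J;
  fiber_trans : forall c d, atlas c -> atlas d ->
    forall x, overlap c d x -> forall A B : 'M[R]_4,
    let tau := trans c d in
    (forall v : coord R, 'D_(A *m v) tau x = B *m 'D_v tau x) ->
    (fiber c x A <-> fiber d (tau x) B) }.

Definition quaternionic_connection (R : realType) (M : manifold4 R)
    (Q : almost_quaternionic M) (N : connection M) : Prop :=
  forall c, atlas c -> forall (U : set (coord R)) (A : coord R -> 'M[R]_4),
  open U -> U `<=` img c -> smooth_on U A ->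
  (forall x, U x -> fiber Q c x (A x)) ->
  forall x u, U x -> fiber Q c x (covEnd N c A x u).

Definition hermitian (R : realType) (M : manifold4 R)
    (Q : almost_quaternionic M) (g : riem_metric M) : Prop :=
  forall c x, atlas c -> img c x -> forall A : 'M[R]_4,
  fiber Q c x A -> A *m A = - 1%:M ->
  forall u v, gdot g c x (A *m u) (A *m v) = gdot g c x u v.

Definition metric_connection (R : realType) (M : manifold4 R)
    (g : riem_metric M) (N : connection M) : Prop :=
  forall c x, atlas c -> img c x ->
  forall u v w, cov_metric N g c x u v w = 0.

Definition torsion3 (R : realType) (M : manifold4 R) (g : riem_metric M)
    (N : connection M) (c : chart R M) (x u v w : coord R) : R :=
  gdot g c x (torsion N c x u v) w.

Definition skew_torsion (R : realType) (M : manifold4 R) (g : riem_metric M)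
    (N : connection M) : Prop :=
  forall c x, atlas c -> img c x -> forall u v w,
  torsion3 g N c x u v w = - torsion3 g N c x v u w /\
  torsion3 g N c x u v w = - torsion3 g N c x u w v.

Definition torsion_type12_21 (R : realType) (M : manifold4 R)
    (Q : almost_quaternionic M) (g : riem_metric M) (N : connection M) : Prop :=
  forall c U J, atlas c -> admissible c (fiber Q c) U J ->
  forall x, U x -> forall a u v w,
  let T := torsion3 g N c x in let Ja v := J a x *m v in
  T u v w = T (Ja u) (Ja v) w + T (Ja u) v (Ja w) + T u (Ja v) (Ja w).

Definition QKT (R : realType) (M : manifold4 R) (Q : almost_quaternionic M)
    (g : riem_metric M) (N : connection M) : Prop :=
  [/\ hermitian Q g, metric_connection g N, quaternionic_connection Q N,
      skew_torsion g N & torsion_type12_21 Q g N].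

(* t = J_a t_a for every a, with t_a(X) = -1/2 sum_i T(X, e_i, J_a e_i) and   *)
(* (J_a t_a)(X) = - t_a(J_a X).                                               *)
Definition torsion_oneform_local (R : realType) (M : manifold4 R)
    (g : riem_metric M) (N : connection M) (c : chart R M) (Ja : 'M[R]_4)
    (e : 'I_4 -> coord R) (x u : coord R) : R :=
  - 2^-1 * \sum_(i < 4) torsion3 g N c x u (e i) (Ja *m e i).

Definition is_torsion_oneform (R : realType) (M : manifold4 R)
    (Q : almost_quaternionic M) (g : riem_metric M) (N : connection M)
    (t : oneform M) : Prop :=
  forall c U J, atlas c -> admissible c (fiber Q c) U J ->
  forall x e, U x -> orthonormal g c x e -> forall a u,
  oneform_at t c x u =
    - torsion_oneform_local g N c (J a x) e x (J a x *m u).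

(* rho_a(X, Y) = 1/2 sum_i g (R(X, Y) e_i, J_a e_i) *)
Definition ricci_form (R : realType) (M : manifold4 R) (g : riem_metric M)
    (N : connection M) (c : chart R M) (Ja : 'M[R]_4) (e : 'I_4 -> coord R)
    (x u v : coord R) : R :=
  2^-1 * \sum_(i < 4) gdot g c x (curvature N c x u v (e i)) (Ja *m e i).

Definition Ktensor (R : realType) (M : manifold4 R) (g : riem_metric M)
    (N : connection M) (c : chart R M) (J : 'I_3 -> 'M[R]_4)
    (e : 'I_4 -> coord R) (x u v : coord R) : R :=
  \sum_(a < 3) ricci_form g N c (J a) e x u (J a *m v).

Definition Sym (R : realType) (B : coord R -> coord R -> R) (u v : coord R) : R :=
  2^-1 * (B u v + B v u).

Definition sp1_einstein (R : realType) (M : manifold4 R)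
    (Q : almost_quaternionic M) (g : riem_metric M) (N : connection M) : Prop :=
  forall c U J, atlas c -> admissible c (fiber Q c) U J ->
  forall x e, U x -> orthonormal g c x e -> forall u v,
  let K := Ktensor g N c (J ^~ x) e x in
  Sym K u v = (\sum_(i < 4) K (e i) (e i)) / 4 * gdot g c x u v.

Definition torsion_free (R : realType) (M : manifold4 R) (N : connection M) :
    Prop :=
  forall c x, atlas c -> img c x -> forall u v, torsion N c x u v = 0.

Definition is_weyl (R : realType) (M : manifold4 R) (g : riem_metric M)
    (t : oneform M) (W : connection M) : Prop :=
  torsion_free W /\
  forall c x, atlas c -> img c x -> forall u v w,
  cov_metric W g c x u v w = - (oneform_at t c x u * gdot g c x v w).

(* Ric(Y, Z) = tr (X |-> R(X, Y) Z) *)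
Definition ricci (R : realType) (M : manifold4 R) (N : connection M)
    (c : chart R M) (x v w : coord R) : R :=
  \sum_(i < 4) curvature N c x (delta_mx i 0) v w i 0.

Definition einstein_weyl (R : realType) (M : manifold4 R) (g : riem_metric M)
    (W : connection M) : Prop :=
  exists f : M -> R, forall c x, atlas c -> img c x -> forall u v,
  Sym (ricci W c x) u v = f (psi c x) * gdot g c x u v.

(* Main.v *)
From HB Require Import structures.
Require Import Defs.
From mathcomp Require Import all_boot all_order all_algebra.
From mathcomp Require Import all_classical all_reals all_analysis.
From mathcomp Require Import ring lra.
Set Implicit Arguments.
Unset Strict Implicit.
Unset Printing Implicit Defensive.
Import Defs.
Import Order.TTheory GRing.Theory Num.Theory numFieldNormedType.Exports.
Local Open Scope classical_set_scope.
Local Open Scope ring_scope.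

(** Write [A_u = Gamma^W(u) - Gamma(u)] for the difference of the Weyl connection
    and the connection with torsion.  Koszul's formula gives
      2 g(A_u v, w) = t(u) g(v, w) + t(v) g(u, w) - t(w) g(u, v) - T(u, v, w).
    In the frame [u, J_1 u, J_2 u, J_3 u], the equations [t = J_a t_a] say that [T]
    is the Hodge dual of [t], and it follows that [A_u] commutes with [J_1], [J_2]
    and [J_3] ([difference_commutes]).  Hence both connections induce the same
    connection on [Q], the commutators of their curvatures with each [J_a] agree
    and lie in [Q], and their Ricci forms [rho_a] are equal ([ricci_form_weyl]).

    The Weyl connection is torsion-free, so its curvature satisfies the first
    Bianchi identity.  Contracting this identity with [J_a] expresses [rho_a]
    through the Ricci tensor and the other two Ricci forms
    ([half_trace_bianchi]).  The three resulting equations imply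
      Sym K = - Sym Ric^W
    ([sym_Ktensor_weyl]).  The equivalence follows: one of the two forms is a
    multiple of [g] if and only if the other is.

    To regard the multiple as a function on the manifold, one needs that it does
    not depend on the chart around a point ([einstein_factor_unique]), i.e. that
    the curvature is a tensor ([curv_mx_change]).  This comes from differentiating
    the transformation law of the Christoffel symbols, and uses, like the Ricci
    identity for the [J_a], the symmetry of second derivatives ([schwarz_mx]). *)

(** * Directional derivatives of matrix-valued functions *)

Lemma is_derive_line (R : realType) (V : normedModType R) (f : V -> R)
    (p u : V) (r : R) :
  derivable f (r *: u + p) u ->
  is_derive r 1 (fun s : R => f (s *: u + p)) ('D_u f (r *: u + p)).
Proof.
have E : (fun h : R => h^-1 *: (((fun s : R => f (s *: u + p)) \o shift r) (h *: 1)
      - f (r *: u + p))) =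
    (fun h : R => h^-1 *: ((f \o shift (r *: u + p)) (h *: u) - f (r *: u + p))).
  by apply/funext => h /=; rewrite [h *: 1]mulr1 scalerDl addrA.
move=> df; split; first by rewrite /derivable E.
by rewrite /derive E.
Qed.

(** A second difference is a mixed second derivative at a nearby point: apply the
    mean value theorem first along [u], then along [v]. *)
Lemma second_difference (R : realType) (V : normedModType R) (f : V -> R)
    (x u v : V) (r h : R) :
  (forall y, `|y - x| < r -> derivable f y u /\ derivable ('D_u f) y v) ->
  0 < h -> h * (`|u| + `|v|) < r ->
  exists2 y, `|y - x| <= h * (`|u| + `|v|) &
  f (h *: u + (h *: v + x)) - f (h *: u + x) - f (h *: v + x) + f x =
    h ^+ 2 * 'D_v ('D_u f) y.
Proof.
move=> df h0 hr.
have small a b : a \in `[0, h] -> b \in `[0, h] ->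
    `|a *: u + (b *: v + x) - x| <= h * (`|u| + `|v|).
  rewrite !in_itv /= => /andP[a0 ah] /andP[b0 bh].
  rewrite addrA addrK (le_trans (ler_normD _ _)) // !normrZ !ger0_norm //.
  by rewrite mulrDr lerD // ler_wpM2r.
have h0in : 0 \in `[0, h] by rewrite in_itv /= lexx ltW.
have hhin : h \in `[0, h] by rewrite in_itv /= lexx ltW.
have sub a : a \in `]0, h[ -> a \in `[0, h].
  by rewrite !in_itv /= => /andP[/ltW -> /ltW ->].
pose w (b a : R) := f (a *: u + (b *: v + x)).
have dw b a : a \in `[0, h] -> b \in `[0, h] ->
    is_derive a 1 (w b) ('D_u f (a *: u + (b *: v + x))).
  move=> ha hb; apply: is_derive_line.
  exact: (df _ (le_lt_trans (small _ _ ha hb) hr)).1.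
have dw' a b : a \in `[0, h] -> b \in `[0, h] ->
    is_derive b 1 (fun b => 'D_u f (a *: u + (b *: v + x)))
      ('D_v ('D_u f) (a *: u + (b *: v + x))).
  move=> ha hb.
  have -> : (fun b => 'D_u f (a *: u + (b *: v + x))) =
     (fun b => 'D_u f (b *: v + (a *: u + x))) by apply/funext => s; rewrite addrCA.
  rewrite addrCA; apply: is_derive_line; rewrite addrCA.
  exact: (df _ (le_lt_trans (small _ _ ha hb) hr)).2.
have cont (g : R -> R) (dg : R -> R) :
   (forall a, a \in `[0, h] -> is_derive a 1 g (dg a)) ->
   {within `[0, h], continuous g}.
  by move=> dgP; apply: derivable_within_continuous => a /dgP [].
have dphi a : a \in `[0, h] -> is_derive a 1 (w h - w 0)
    ('D_u f (a *: u + (h *: v + x)) - 'D_u f (a *: u + (0 *: v + x))).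
  by move=> ha; have := dw _ _ ha hhin; have := dw _ _ ha h0in => ??; apply: is_deriveB.
have [xi xih Exi] := MVT h0 (fun a ha => dphi a (sub _ ha)) (cont _ _ dphi).
have xih' := sub _ xih.
have [eta etah Eeta] := MVT h0 (fun b hb => dw' xi b xih' (sub _ hb))
  (cont _ _ (fun b hb => dw' xi b xih' hb)).
exists (xi *: u + (eta *: v + x)); first by apply: small => //; exact: sub.
move: Exi Eeta; rewrite !fctE /w !scale0r !add0r !subr0 => Exi Eeta.
rewrite Eeta in Exi; rewrite expr2; lra.
Qed.

Lemma norm_sub_half (R : realType) (e a b c : R) :
  `|a - c| < e / 2 -> `|b - c| < e / 2 -> `|a - b| <= e.
Proof.
move=> ac bc; rewrite -(subrKA c) (le_trans (ler_normD _ _)) //.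
by rewrite (splitr e) lerD // ?[`|c - b|]distrC ltW.
Qed.

(** Symmetry of second derivatives: both mixed derivatives are limits of the
    same second difference quotient. *)
Lemma schwarz_scalar (R : realType) (V : normedModType R) (f : V -> R) (x u v : V) :
  (\forall y \near x, [/\ derivable f y u, derivable f y v,
     derivable ('D_u f) y v & derivable ('D_v f) y u]) ->
  {for x, continuous ('D_v ('D_u f))} -> {for x, continuous ('D_u ('D_v f))} ->
  'D_v ('D_u f) x = 'D_u ('D_v f) x.
Proof.
move=> /nbhs_ballP[r r0 dr] cvu cuv.
apply/eqP; rewrite -subr_eq0 -normr_le0; apply/ler_addgt0Pr => e e0.
rewrite add0r.
have e2 : 0 < e / 2 by lra.
have : \forall y \near x, `|'D_u ('D_v f) x - 'D_u ('D_v f) y| < e / 2.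
  exact: (cvgrPdist_lt _ _).1 cuv _ e2.
have : \forall y \near x, `|'D_v ('D_u f) x - 'D_v ('D_u f) y| < e / 2.
  exact: (cvgrPdist_lt _ _).1 cvu _ e2.
move=> /nbhs_ballP[r2 r20 H2] /nbhs_ballP[r1 r10 H1].
rewrite /= in r0 r10 r20.
have [s [s0 sr s1 s2]] : exists s, [/\ 0 < s, s <= r, s <= r1 & s <= r2].
  exists (Num.min r (Num.min r1 r2)).
  by rewrite !lt_min r0 r10 r20 !ge_min !lexx !orbT.
have [h h0 hs] : exists2 h, 0 < h & h * (`|u| + `|v|) < s.
  have n0 : 0 <= `|u| + `|v| by rewrite addr_ge0.
  exists (s / (`|u| + `|v| + 1)); first by rewrite divr_gt0 //; lra.
  by rewrite -mulrA gtr_pMr // ltr_pdivrMl ?mulr1; lra.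
have hr := lt_le_trans hs sr.
have bxy (y : V) q : `|y - x| < q -> ball x q y by rewrite -ball_normE /= distrC.
have [y1 y1h E1] := @second_difference R V f x u v r h
  (fun y hy => let: And4 a b c d := dr y (bxy _ _ hy) in conj a c) h0 hr.
have hr' : h * (`|v| + `|u|) < r by rewrite [_ + `|u|]addrC.
have [y2 y2h E2] := @second_difference R V f x v u r h
  (fun y hy => let: And4 a b c d := dr y (bxy _ _ hy) in conj b d) h0 hr'.
have E : 'D_v ('D_u f) y1 = 'D_u ('D_v f) y2.
  apply: (mulfI (x := h ^+ 2)); first by rewrite gt_eqF // exprn_gt0.
  apply: (etrans (esym E1)); apply: etrans E2.
  rewrite (_ : h *: v + (h *: u + x) = h *: u + (h *: v + x)); last exact: addrCA.
  by congr (_ + _); rewrite addrAC.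
have B1 := bxy _ _ (le_lt_trans y1h (lt_le_trans hs s2)).
rewrite [`|v| + _]addrC in y2h.
have B2 := bxy _ _ (le_lt_trans y2h (lt_le_trans hs s1)).
move: (H2 _ B1) (H1 _ B2); rewrite /= E.
exact: norm_sub_half.
Qed.

Lemma derive_mxE (R : realType) (V : normedModType R) m n (M : V -> 'M[R]_(m, n))
    (x v : V) i j :
  derivable M x v -> ('D_v M x) i j = 'D_v (fun y => M y i j) x.
Proof. by move=> dM; rewrite derive_mx // mxE. Qed.

Lemma is_derive_mxP (R : realType) (V : normedModType R) m n
    (M : V -> 'M[R]_(m, n)) (x v : V) (dM : 'M[R]_(m, n)) :
  (forall i j, is_derive x v (fun y => M y i j) (dM i j)) -> is_derive x v M dM.
Proof.
move=> H; have dM' : derivable M x v by apply/derivable_mxP => i j; case: (H i j).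
split=> //; apply/matrixP => i j; rewrite derive_mxE //.
by case: (H i j).
Qed.

Lemma is_derive_entry (R : realType) (V : normedModType R) m n
    (M : V -> 'M[R]_(m, n)) (x v : V) dM i j :
  is_derive x v M dM -> is_derive x v (fun y => M y i j) (dM i j).
Proof.
case=> dM' <-; split; last by rewrite derive_mxE.
by move/derivable_mxP: dM'.
Qed.

Lemma is_derive_bigsum (R : realType) (V W : normedModType R) (I : Type) (s : seq I)
    (f : I -> V -> W) (x v : V) df :
  (forall i, is_derive x v (f i) (df i)) ->
  is_derive x v (fun y => \sum_(i <- s) f i y) (\sum_(i <- s) df i).
Proof.
move=> H; elim: s => [|i s IH].
  rewrite big_nil; have -> : (fun y => \sum_(i <- [::]) f i y) = cst 0.
    by apply/funext => y; rewrite big_nil.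
  exact: is_derive_cst.
rewrite big_cons; have -> : (fun y => \sum_(j <- i :: s) f j y) =
   f i + (fun y => \sum_(j <- s) f j y).
  by apply/funext => y; rewrite big_cons.
exact: is_deriveD.
Qed.

Lemma is_derive_mulmx (R : realType) (V : normedModType R) m n p
    (A : V -> 'M[R]_(m, n)) (B : V -> 'M[R]_(n, p)) (x v : V) dA dB :
  is_derive x v A dA -> is_derive x v B dB ->
  is_derive x v (fun y => A y *m B y) (dA *m B x + A x *m dB).
Proof.
move=> HA HB; apply: is_derive_mxP => i j.
have -> : (fun y => (A y *m B y) i j) = (fun y => \sum_k A y i k * B y k j).
  by apply/funext => y; rewrite mxE.
rewrite !mxE -big_split /=; apply: is_derive_bigsum => k.
have H1 := is_derive_entry i k HA; have H2 := is_derive_entry k j HB.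
apply: is_derive_eq (is_deriveM H1 H2) _.
by rewrite addrC /GRing.scale /= [B x k j * _]mulrC.
Qed.

Lemma is_derive_mulmx_cst (R : realType) (V : normedModType R) m n p
    (A : V -> 'M[R]_(m, n)) (w : 'M[R]_(n, p)) (x v : V) dA :
  is_derive x v A dA -> is_derive x v (fun y => A y *m w) (dA *m w).
Proof.
move=> HA; apply: is_derive_eq (is_derive_mulmx HA (is_derive_cst w x v)) _.
by rewrite mulmx0 addr0.
Qed.

Lemma is_derive_scale (R : realType) (V : normedModType R) m n
    (a : V -> R) (B : V -> 'M[R]_(m, n)) (x v : V) da dB :
  is_derive x v a da -> is_derive x v B dB ->
  is_derive x v (fun y => a y *: B y) (da *: B x + a x *: dB).
Proof.
move=> Ha HB; apply: is_derive_mxP => i j.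
have -> : (fun y => (a y *: B y) i j) = a * (fun y => B y i j).
  by apply/funext => y; rewrite mxE.
rewrite !mxE; apply: is_derive_eq (is_deriveM Ha (is_derive_entry i j HB)) _.
by rewrite addrC /GRing.scale /= [B x i j * _]mulrC.
Qed.

(** The chain rule for directional derivatives. *)
Lemma is_derive_comp_dir (R : realType) (V V' W : normedModType R)
    (f : V -> V') (g : V' -> W) (x v : V) :
  differentiable f x -> differentiable g (f x) ->
  is_derive x v (fun y => g (f y)) ('D_('D_v f x) g (f x)).
Proof.
move=> df dg; have dgf := differentiable_comp df dg; split.
  exact: (@diff_derivable _ _ _ (g \o f)).
by rewrite -[fun y => _]/(g \o f) (deriveE _ dgf) diff_comp // !deriveE.
Qed.

Lemma derive_linear (R : realType) (V W : normedModType R) (f : V -> W) (x : V) :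
  differentiable f x -> linear (fun v => 'D_v f x).
Proof. by move=> df a u v; rewrite !deriveE // linearP. Qed.

Lemma smooth_on_differentiable (R : realType) (V W : normedModType R) (U : set V) (f : V -> W)
    x : smooth_on U f -> U x -> differentiable f x.
Proof. by move=> /(_ 1%N) [H _] /H. Qed.

Lemma smooth_on_derive (R : realType) (V W : normedModType R) (U : set V)
    (f : V -> W) v :
  smooth_on U f -> smooth_on U ('D_v f).
Proof. by move=> H k; have [_] := H k.+1; apply. Qed.

Lemma smooth_derivable (R : realType) (V W : normedModType R) (U : set V)
    (f : V -> W) x v :
  smooth_on U f -> U x -> derivable f x v.
Proof. by move=> H /(smooth_on_differentiable H) /diff_derivable; apply. Qed.

Lemma near_open (V : topologicalType) (U : set V) (P : V -> Prop) x :
  open U -> U x -> (forall y, U y -> P y) -> \forall y \near x, P y.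
Proof. by move=> oU Ux H; apply: filterS (open_nbhs_nbhs (conj oU Ux)). Qed.

Lemma schwarz_mx (R : realType) (V : normedModType R) m n (U : set V)
    (F : V -> 'M[R]_(m, n)) (x u v : V) :
  open U -> smooth_on U F -> U x -> 'D_v ('D_u F) x = 'D_u ('D_v F) x.
Proof.
move=> oU sF Ux; apply/matrixP => i j.
pose f (y : V) : R := F y i j.
have D w y : U y -> 'D_w f y = ('D_w F) y i j.
  by move=> Uy; rewrite derive_mxE //; exact: smooth_derivable sF Uy.
have dentry (G : V -> 'M[R]_(m, n)) w y : smooth_on U G -> U y ->
    derivable (fun z => G z i j : R) y w.
  by move=> sG Uy; have /derivable_mxP := smooth_derivable (v := w) sG Uy.
have ND w y : U y -> {near y, (fun z => ('D_w F) z i j) =1 'D_w f}.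
  by move=> Uy; apply: (near_open oU Uy) => z Uz; rewrite D.
have DD w w' y : U y -> 'D_w' ('D_w f) y = ('D_w' ('D_w F)) y i j.
  move=> Uy; rewrite derive_mxE; last exact: smooth_derivable (smooth_on_derive _ sF) Uy.
  by apply: near_eq_derive; apply: (near_open oU Uy) => z; exact: D.
have cDD w w' : {for x, continuous ('D_w' ('D_w f))}.
  have c : {for x, continuous (fun y => ('D_w' ('D_w F)) y i j)}.
    apply: (@continuous_comp _ _ _ ('D_w' ('D_w F)) (fun M : 'M[R]_(m, n) => M i j)).
      exact: ((smooth_on_derive w' (smooth_on_derive w sF)) 0%N).
    exact: coord_continuous.
  rewrite /prop_for /continuous_at DD //; apply: cvg_trans c.
  apply: near_eq_cvg; apply: (near_open oU Ux) => z Uz.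
  by rewrite [RHS]DD.
suff S : 'D_v ('D_u f) x = 'D_u ('D_v f) x.
  exact: etrans (esym (DD u v _ Ux)) (etrans S (DD v u _ Ux)).
apply: schwarz_scalar.
2: exact: cDD.
2: exact: cDD.
apply: (near_open oU Ux) => y Uy.
have d2 w w' : derivable ('D_w f) y w'.
  apply: near_eq_derivable (ND w y Uy) _.
  exact: dentry (smooth_on_derive w sF) Uy.
by split; [exact: dentry sF Uy|exact: dentry sF Uy|exact: d2|exact: d2].
Qed.

(** * Quaternionic triples of matrices *)

(** The relations between the imaginary units [A], [B], [C] of the quaternions, with
    three separate arguments so that cyclic permutations can be expressed. *)
Definition qtriple (R : realType) (A B C : 'M[R]_4) : Prop :=
  [/\ A *m A = - 1%:M, B *m B = - 1%:M, A *m B = C & B *m A = - C].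

Lemma qtriple_rot (R : realType) (A B C : 'M[R]_4) :
  qtriple A B C -> qtriple B C A.
Proof.
case=> AA BB AB BA.
have BC : B *m C = A.
  by rewrite -[C]opprK -BA mulmxN mulmxA BB mulNmx mul1mx opprK.
have CB : C *m B = - A by rewrite -AB -mulmxA BB mulmxN mulmx1.
by split => //; rewrite -{1}AB -mulmxA BC.
Qed.

Lemma qtriple_mul (R : realType) (A B C : 'M[R]_4) : qtriple A B C ->
  (A *m A = - 1%:M) * (B *m B = - 1%:M) * (C *m C = - 1%:M) *
  (A *m B = C) * (B *m C = A) * (C *m A = B) *
  (B *m A = - C) * (C *m B = - A) * (A *m C = - B).
Proof. by move=> q; have [] := q; have [] := qtriple_rot q;
  have [] := qtriple_rot (qtriple_rot q) => *; do !split. Qed.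

Lemma qtriple_tr0 (R : realType) (A B C : 'M[R]_4) : qtriple A B C -> \tr C = 0.
Proof.
case=> _ _ AB BA; have := mxtrace_mulC A B.
by rewrite AB BA raddfN /= => H; lra.
Qed.

(** If [[A, X]] lies in the span of [A, B, C], its coordinates are given by the
    traces of [B X] and [C X]: multiply by each unit and take traces. *)
Lemma qtriple_commutator (R : realType) (A B C X : 'M[R]_4) (a b c : R) :
  qtriple A B C -> A *m X - X *m A = a *: A + b *: B + c *: C ->
  A *m X - X *m A = (- 2^-1 * \tr (B *m X)) *: C - (- 2^-1 * \tr (C *m X)) *: B.
Proof.
move=> q E; have m := qtriple_mul q.
have tC := qtriple_tr0 q; have tA := qtriple_tr0 (qtriple_rot q).
have tB := qtriple_tr0 (qtriple_rot (qtriple_rot q)).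
have t1 : \tr (- 1%:M : 'M[R]_4) = - 4%:R by rewrite raddfN /= mxtrace1.
have trE (D : 'M[R]_4) : \tr (D *m A *m X) - \tr (A *m D *m X) =
    a * \tr (D *m A) + b * \tr (D *m B) + c * \tr (D *m C).
  have := congr1 (fun Y => \tr (D *m Y)) E.
  rewrite mulmxBr !mulmxDr -!scalemxAr !raddfD raddfN /= !linearZ /= !mulmxA => <-.
  by rewrite [\tr (D *m X *m A)]mxtrace_mulC mulmxA.
have HA := trE A; have HB := trE B; have HC := trE C.
rewrite ?m ?mulNmx ?raddfN /= ?m ?tA ?tB ?tC ?mxtrace1 in HA HB HC.
have a0 : a = 0 by lra.
have -> : - 2^-1 * \tr (B *m X) = c by lra.
have -> : - 2^-1 * \tr (C *m X) = - b by lra.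
by rewrite E a0 scale0r add0r scaleNr opprK addrC.
Qed.

(** The trace of [A X] depends only on [[B, X]], since [A = B C = - C B]. *)
Lemma tr_commuting (R : realType) (A B C X Y : 'M[R]_4) : qtriple A B C ->
  B *m X - X *m B = B *m Y - Y *m B -> \tr (A *m X) = \tr (A *m Y).
Proof.
move=> q E; have m := qtriple_mul q.
have H Z : \tr (C *m (B *m Z - Z *m B)) = - 2 * \tr (A *m Z).
  rewrite mulmxBr raddfB /= !mulmxA m [\tr (C *m Z *m B)]mxtrace_mulC mulmxA m.
  rewrite mulNmx raddfN /=; ring.
have := H X; rewrite E H => H1; lra.
Qed.

(** * An algebraic identity for curvature tensors of quaternionic type *)

Section curvature_algebra.
Variables (R : realType) (K : 'cV[R]_4 -> 'cV[R]_4 -> 'M[R]_4).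
Hypothesis K_linear : forall u, linear (K u).
Hypothesis K_skew : forall u v, K u v = - K v u.
Hypothesis bianchi : forall u v w, K u v *m w + K v w *m u + K w u *m v = 0.

(** The Ricci form of [K] that belongs to the unit [A], without reference to a metric. *)
Definition half_trace (A : 'M[R]_4) (u v : 'cV[R]_4) : R := - 2^-1 * \tr (A *m K u v).

(** The Ricci tensor of [K], the trace of [x |-> K(x, v) w]. *)
Definition trace_ric (v w : 'cV[R]_4) : R := \sum_(i < 4) (K (delta_mx i 0) v *m w) i 0.

Local Notation r := half_trace.
Local Notation ric := trace_ric.

Lemma half_trace_linear A u : linear (fun v => half_trace A u v : R^o).
Proof.
move=> a v w; rewrite /half_trace K_linear mulmxDr -scalemxAr !linearP /=.
rewrite /GRing.scale /=; ring.
Qed.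

Lemma curvatureNr u v : K u (- v) = - K u v.
Proof.
have K0 : K u 0 = 0.
  have := K_linear u 1 0 0; rewrite !scale1r addr0 => /eqP.
  by rewrite -subr_eq subrr eq_sym => /eqP.
by have := K_linear u (-1) v 0; rewrite !scaleN1r K0 !addr0.
Qed.

Lemma half_traceNr A u v : r A u (- v) = - r A u v.
Proof. by rewrite /half_trace curvatureNr mulmxN raddfN /= mulrN. Qed.

Lemma half_trace_skew A u v : r A u v = - r A v u.
Proof. by rewrite /half_trace K_skew mulmxN raddfN /= mulrN. Qed.

Lemma half_trace_sum A u (x : 'cV[R]_4) :
  \sum_(i < 4) r A u (delta_mx i 0) * x i 0 = r A u x.
Proof.
pose L : {linear 'cV[R]_4 -> R^o} :=
  HB.pack (half_trace A u) (GRing.isLinear.Build _ _ _ _ _ (@half_trace_linear A u)).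
have -> : r A u x = L x by [].
rewrite {2}(matrix_sum_delta x) linear_sum; apply: eq_bigr => i _.
by rewrite big_ord1 linearZ; apply: mulrC.
Qed.

Lemma trace_ricNr v w : ric v (- w) = - ric v w.
Proof. by rewrite -sumrN; apply: eq_bigr => i _; rewrite mulmxN mxE. Qed.

Lemma trace_ricNl v w : ric (- v) w = - ric v w.
Proof.
rewrite -sumrN; apply: eq_bigr => i _.
by rewrite curvatureNr mulNmx mxE.
Qed.

Lemma trace_delta (X : 'M[R]_4) : \tr X = \sum_(i < 4) (X *m delta_mx i 0) i (0 : 'I_1).
Proof. by apply: eq_bigr => i _; rewrite -colE mxE. Qed.

(** Moving [A] past the curvature in the contraction of [A K(y, .) x] produces the
    Ricci tensor and the Ricci forms of the other two units. *)
Lemma trace_commuted (A B C : 'M[R]_4) y x :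
  (forall u v, A *m K u v - K u v *m A = r B u v *: C - r C u v *: B) ->
  \sum_(i < 4) (A *m K y (delta_mx i 0) *m x) i 0 =
  - ric y (A *m x) + r B y (C *m x) - r C y (B *m x).
Proof.
move=> com.
rewrite -!half_trace_sum -sumrN -!sumrN -!big_split /=; apply: eq_bigr => i _.
have -> : A *m K y (delta_mx i 0) = K y (delta_mx i 0) *m A +
   (r B y (delta_mx i 0) *: C - r C y (delta_mx i 0) *: B).
  by rewrite -com addrC subrK.
rewrite mulmxDl mulmxBl -!scalemxAl -mulmxA [K y _]K_skew mulNmx.
move: (K _ y *m _) (C *m x) (B *m x) => P X Y.
by rewrite !mxE addrA.
Qed.

Lemma half_trace_bianchi (A B C : 'M[R]_4) x y :
  (forall u v, A *m K u v - K u v *m A = r B u v *: C - r C u v *: B) ->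
  2 * r A x y = (- ric y (A *m x) + r B y (C *m x) - r C y (B *m x))
              - (- ric x (A *m y) + r B x (C *m y) - r C x (B *m y)).
Proof.
move=> com; rewrite -!(trace_commuted _ _ com).
rewrite {1}/half_trace mulrA mulrN mulfV ?pnatr_eq0 // mulN1r trace_delta.
rewrite -!sumrN -big_split /=; apply: eq_bigr => i _.
have := bianchi x y (delta_mx i 0); move/eqP.
rewrite -addrA addr_eq0 => /eqP E.
rewrite -mulmxA E mulmxN mulmxDr mulmxA [K (delta_mx i 0) x]K_skew mulNmx mulmxN mulmxA.
by rewrite !mxE opprK.
Qed.

(** Let [S(x, y)] be the symmetrisation of [sum_a r_a(x, J_a y) + Ric(x, y)].  The
    three identities of [half_trace_bianchi] add up to [3 S = - sum_a S(J_a ., J_a .)], and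
    this equation, used again at [(J_b x, J_b y)], forces [S = 0]. *)
Lemma sym_half_trace_ric (A B C : 'M[R]_4) u v :
  qtriple A B C ->
  (forall u v, A *m K u v - K u v *m A = r B u v *: C - r C u v *: B) ->
  (forall u v, B *m K u v - K u v *m B = r C u v *: A - r A u v *: C) ->
  (forall u v, C *m K u v - K u v *m C = r A u v *: B - r B u v *: A) ->
  Sym (fun x y => r A x (A *m y) + r B x (B *m y) + r C x (C *m y)) u v =
  - Sym ric u v.
Proof.
move=> q cA cB cC; have m := qtriple_mul q.
pose k x y := r A x (A *m y) + r B x (B *m y) + r C x (C *m y).
pose S x y := k x y + k y x + ric x y + ric y x.
have avg x y : 3 * S x y = - S (A *m x) (A *m y) - S (B *m x) (B *m y)
    - S (C *m x) (C *m y).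
  have EA := half_trace_bianchi x (A *m y) cA.
  have EB := half_trace_bianchi x (B *m y) cB.
  have EC := half_trace_bianchi x (C *m y) cC.
  have FA := half_trace_bianchi y (A *m x) cA.
  have FB := half_trace_bianchi y (B *m x) cB.
  have FC := half_trace_bianchi y (C *m x) cC.
  rewrite !mulmxA !m !mulNmx !mul1mx ?half_traceNr ?trace_ricNr in EA EB EC FA FB FC.
  rewrite /S /k !mulmxA !m !mulNmx !mul1mx !half_traceNr.
  rewrite (half_trace_skew A (A *m x) y) (half_trace_skew A (A *m y) x).
  rewrite (half_trace_skew B (B *m x) y) (half_trace_skew B (B *m y) x).
  rewrite (half_trace_skew C (C *m x) y) (half_trace_skew C (C *m y) x).
  rewrite (half_trace_skew B (A *m y) (C *m x)) (half_trace_skew C (A *m y) (B *m x))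
    (half_trace_skew C (B *m y) (A *m x)) (half_trace_skew A (B *m y) (C *m x))
    (half_trace_skew A (C *m y) (B *m x)) (half_trace_skew B (C *m y) (A *m x))
    in EA EB EC FA FB FC *.
  lra.
have SN x y : S (- x) (- y) = S x y.
  have rNN D z w : r D (- z) (- w) = r D z w.
    by rewrite half_traceNr half_trace_skew half_traceNr opprK -half_trace_skew.
  by rewrite /S /k !mulmxN !rNN !trace_ricNl !trace_ricNr !opprK.
have E0 := avg u v.
have E1 := avg (A *m u) (A *m v); have E2 := avg (B *m u) (B *m v).
have E3 := avg (C *m u) (C *m v).
rewrite !mulmxA !m !mulNmx !mul1mx !SN in E1 E2 E3.
have : S u v = 0 by lra.
rewrite /Sym -/(k u v) -/(k v u) /S => E; lra.
Qed.

End curvature_algebra.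

(** * Inner products invariant under a quaternionic triple *)

Lemma mulmx_vec_inj (R : realType) m n (A B : 'M[R]_(m, n)) :
  (forall w : 'cV[R]_n, A *m w = B *m w) -> A = B.
Proof.
move=> H; apply/matrixP => i j; have := H (delta_mx j 0).
by rewrite -!colE => /matrixP /(_ i 0); rewrite !mxE.
Qed.

Section inner_product.
Variables (R : realType) (G : 'M[R]_4).
Hypothesis G_sym : G^T = G.
Hypothesis G_pos : forall u : 'cV[R]_4, u != 0 -> 0 < (u^T *m G *m u) 0 0.

Definition dot (u v : 'cV[R]_4) : R := (u^T *m G *m v) 0 0.

Lemma dotC u v : dot u v = dot v u.
Proof.
rewrite /dot -[in LHS](trmxK (_ *m v)) mxE !trmx_mul trmxK G_sym.
by rewrite mulmxA.
Qed.

Lemma dotDr u v w : dot u (v + w) = dot u v + dot u w.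
Proof. by rewrite /dot mulmxDr mxE. Qed.

Lemma dotZr a u v : dot u (a *: v) = a * dot u v.
Proof. by rewrite /dot -scalemxAr mxE. Qed.

Lemma dotNr u v : dot u (- v) = - dot u v.
Proof. by rewrite -scaleN1r dotZr mulN1r. Qed.

Lemma dotDl u v w : dot (u + v) w = dot u w + dot v w.
Proof. by rewrite dotC dotDr !(dotC w). Qed.

Lemma dotZl a u v : dot (a *: u) v = a * dot u v.
Proof. by rewrite dotC dotZr dotC. Qed.

Lemma dotNl u v : dot (- u) v = - dot u v.
Proof. by rewrite dotC dotNr dotC. Qed.

Lemma dot_nondegenerate u : (forall v, dot u v = 0) -> u = 0.
Proof. by move=> H; apply/eqP/negPn/negP => /G_pos; rewrite -/(dot u u) H ltxx. Qed.

(** Orthonormal frames for [dot]. *)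
Definition is_orthonormal (e : 'I_4 -> 'cV[R]_4) : Prop :=
  forall i j, dot (e i) (e j) = (i == j)%:R.

(** The matrix [E] whose columns are the frame satisfies [E^T G E = 1]; the inverse
    is two-sided. *)
Lemma orthonormal_frame_mul e : is_orthonormal e ->
  let E := \matrix_(i, j) e j i 0 in E *m (E^T *m G) = 1%:M.
Proof.
move=> He E; apply: mulmx1C; apply/matrixP => i j.
rewrite [RHS]mxE -He /dot.
have cE k : e k = col k E by apply/matrixP => a b; rewrite !mxE !ord1.
rewrite !cE tr_col -!row_mul [LHS]mxE mxE [RHS]mxE.
by apply: eq_bigr => k _; rewrite [col j E _ _]mxE.
Qed.

Lemma orthonormal_expand e v : is_orthonormal e ->
  exists c : 'I_4 -> R, v = \sum_i c i *: e i.
Proof.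
move=> He; pose E := \matrix_(i, j) e j i 0.
exists (fun i => (E^T *m G *m v) i 0).
rewrite -[LHS]mul1mx -(orthonormal_frame_mul He) -/E -mulmxA.
apply/matrixP => i j; rewrite ord1 mxE summxE; apply: eq_bigr => k _.
by rewrite !(mxE _ (_ *: _)) [E _ _]mxE mulrC.
Qed.

Lemma orthonormal_trace e (X : 'M[R]_4) : is_orthonormal e ->
  \sum_i dot (X *m e i) (e i) = \tr X.
Proof.
move=> He; pose E := \matrix_(i, j) e j i 0.
rewrite -[X in RHS]mulmx1 -(orthonormal_frame_mul He) -/E mulmxA mxtrace_mulC.
apply: eq_bigr => i _; rewrite dotC /dot.
have cE k : e k = col k E by apply/matrixP => a b; rewrite !mxE !ord1.
have -> : X *m e i = col i (X *m E) by rewrite cE !colE mulmxA.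
rewrite cE tr_col -!row_mul [LHS]mxE mxE [RHS]mxE.
by apply: eq_bigr => k _; rewrite [col i _ _ _]mxE.
Qed.

(** Linear forms on [R^4]. *)
Definition scalar_form (f : 'cV[R]_4 -> R) : Prop :=
  forall a u v, f (a *: u + v) = a * f u + f v.

Lemma scalar_form0 f : scalar_form f -> f 0 = 0.
Proof. by move=> H; have := H 1 0 0; rewrite scaler0 addr0; lra. Qed.

Lemma scalar_formZ f a u : scalar_form f -> f (a *: u) = a * f u.
Proof. by move=> H; rewrite -[a *: u]addr0 H scalar_form0 // addr0. Qed.

Lemma scalar_formN f u : scalar_form f -> f (- u) = - f u.
Proof. by move=> H; rewrite -scaleN1r scalar_formZ // mulN1r. Qed.

Lemma scalar_form_eq0 f e v : scalar_form f -> is_orthonormal e ->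
  (forall i, f (e i) = 0) -> f v = 0.
Proof.
move=> H He fe; have [c ->] := orthonormal_expand v He.
elim/big_ind: _ => [|x y Hx Hy|i _]; first exact: scalar_form0.
  by rewrite -[x]scale1r H Hx Hy mulr0 addr0.
by rewrite scalar_formZ // fe mulr0.
Qed.

Section quaternionic_frame.
Variables A B C : 'M[R]_4.
Hypothesis q : qtriple A B C.
Hypothesis A_orth : forall u v, dot (A *m u) (A *m v) = dot u v.
Hypothesis B_orth : forall u v, dot (B *m u) (B *m v) = dot u v.
Hypothesis C_orth : forall u v, dot (C *m u) (C *m v) = dot u v.

Lemma dot_skew_unit (D : 'M[R]_4) u v : D *m D = - 1%:M ->
  (forall u v, dot (D *m u) (D *m v) = dot u v) ->
  dot (D *m u) v = - dot u (D *m v).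
Proof.
move=> DD DO; rewrite -[in RHS](DO u) mulmxA DD mulNmx mul1mx.
by rewrite dotNr opprK.
Qed.

(** The orthogonal frame [u, A u, B u, C u]; its vectors have the length of [u]. *)
Definition quat_frame (u : 'cV[R]_4) (i : 'I_4) : 'cV[R]_4 :=
  nth 0 [:: u; A *m u; B *m u; C *m u] i.

Lemma quat_frame_dots u : let n := dot u u in
  (dot u (A *m u) = 0) * (dot u (B *m u) = 0) * (dot u (C *m u) = 0) *
  (dot (A *m u) u = 0) * (dot (B *m u) u = 0) * (dot (C *m u) u = 0) *
  (dot (A *m u) (B *m u) = 0) * (dot (B *m u) (A *m u) = 0) *
  (dot (A *m u) (C *m u) = 0) * (dot (C *m u) (A *m u) = 0) *
  (dot (B *m u) (C *m u) = 0) * (dot (C *m u) (B *m u) = 0) *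
  (dot (A *m u) (A *m u) = n) * (dot (B *m u) (B *m u) = n) *
  (dot (C *m u) (C *m u) = n).
Proof.
move=> n; have m := qtriple_mul q.
have sk D : D *m D = - 1%:M -> (forall u v, dot (D *m u) (D *m v) = dot u v) ->
    dot u (D *m u) = 0.
  by move=> DD DO; have := dot_skew_unit u u DD DO; rewrite dotC => ?; lra.
have uA : dot u (A *m u) = 0 by apply: sk => //; rewrite m.
have uB : dot u (B *m u) = 0 by apply: sk => //; rewrite m.
have uC : dot u (C *m u) = 0 by apply: sk => //; rewrite m.
have AB : dot (A *m u) (B *m u) = 0.
  by rewrite dot_skew_unit ?m // mulmxA m uC oppr0.
have BC : dot (B *m u) (C *m u) = 0.
  by rewrite dot_skew_unit ?m // mulmxA m uA oppr0.
have CA : dot (C *m u) (A *m u) = 0.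
  by rewrite dot_skew_unit ?m // mulmxA m uB oppr0.
by do !split => //; rewrite dotC.
Qed.

Lemma quat_frame_orthonormal u : u != 0 ->
  is_orthonormal (fun i => (Num.sqrt (dot u u))^-1 *: quat_frame u i).
Proof.
move=> u0 i j; rewrite dotZl dotZr mulrA -expr2 exprVn sqr_sqrtr ?ltW ?G_pos //.
have n0 : dot u u != 0 by rewrite gt_eqF // G_pos.
have D := quat_frame_dots u.
case: i => [[|[|[|[|//]]]] ?]; case: j => [[|[|[|[|//]]]] ?];
  by rewrite /quat_frame /= ?D ?mulVf ?mulr0.
Qed.

(** A 1-form [t] and a 3-form [T] related as the torsion 1-form and the torsion. *)
Variables (t : 'cV[R]_4 -> R) (T : 'cV[R]_4 -> 'cV[R]_4 -> 'cV[R]_4 -> R).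
Hypothesis t_lin : scalar_form t.
Hypothesis T_lin1 : forall v w, scalar_form (fun u => T u v w).
Hypothesis T_lin2 : forall u w, scalar_form (fun v => T u v w).
Hypothesis T_lin3 : forall u v, scalar_form (T u v).
Hypothesis T_skew12 : forall u v w, T u v w = - T v u w.
Hypothesis T_skew23 : forall u v w, T u v w = - T u w v.

(* [t = J t_J] for the unit [J = D], with the two signs multiplied out.       *)
Let is_lee (D : 'M[R]_4) := forall e u, is_orthonormal e ->
  t u = 2^-1 * \sum_(i < 4) T (D *m u) (e i) (D *m e i).
Hypothesis t_A : is_lee A.
Hypothesis t_B : is_lee B.
Hypothesis t_C : is_lee C.

Let TNl u v w : T (- u) v w = - T u v w. Proof. exact: (scalar_formN _ (T_lin1 v w)). Qed.
Let TNm u v w : T u (- v) w = - T u v w. Proof. exact: (scalar_formN _ (T_lin2 u w)). Qed.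
Let TNr u v w : T u v (- w) = - T u v w. Proof. exact: (scalar_formN _ (T_lin3 u v)). Qed.
Let T112 u w : T u u w = 0. Proof. by have := T_skew12 u u w; lra. Qed.
Let T122 u w : T u w w = 0. Proof. by have := T_skew23 u w w; lra. Qed.
Let T121 u w : T u w u = 0. Proof. by rewrite T_skew23 T112 oppr0. Qed.

(** The relation between [t] and [T], in the frame of [u] rescaled to length 1. *)
Lemma torsion_in_frame (D : 'M[R]_4) u : u != 0 -> is_lee D -> D *m D = - 1%:M ->
  - (2 * dot u u) * t (D *m u) =
  \sum_(i < 4) T u (quat_frame u i) (D *m quat_frame u i).
Proof.
move=> u0 HD DD; have n0 : dot u u != 0 by rewrite gt_eqF // G_pos.
rewrite (HD _ _ (quat_frame_orthonormal u0)) mulmxA DD mulNmx mul1mx.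
have -> : \sum_(i < 4) T (- u) ((Num.sqrt (dot u u))^-1 *: quat_frame u i)
    (D *m ((Num.sqrt (dot u u))^-1 *: quat_frame u i)) =
  - (dot u u)^-1 * \sum_(i < 4) T u (quat_frame u i) (D *m quat_frame u i).
  rewrite mulr_sumr; apply: eq_bigr => i _.
  rewrite TNl (scalar_formZ _ _ (T_lin2 u _)) -scalemxAr (scalar_formZ _ _ (T_lin3 u _)).
  by rewrite mulrA -expr2 exprVn sqr_sqrtr ?ltW ?G_pos // mulNr.
by field.
Qed.

(** The part of the 2-form [T(u, ., .)] that does not commute with [A], in terms of
    [t].  Both sides are bilinear in [v, w], so it is enough to compare them on
    the frame of [u], where [T(u, B u, C u) = - g(u, u) t(A u)] and cyclically. *)
Lemma torsion_commutator u v w :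
  T u (A *m v) w + T u v (A *m w) =
  t (A *m v) * dot u w - t w * dot u (A *m v)
  + t v * dot u (A *m w) - t (A *m w) * dot u v.
Proof.
have m := qtriple_mul q.
have [->|u0] := eqVneq u 0.
  have -> x y : T 0 x y = 0 by exact: (scalar_form0 (T_lin1 x y)).
  have -> x y : T 0 x y = 0 by exact: (scalar_form0 (T_lin1 x y)).
  have d0 x : dot 0 x = 0 by rewrite -(scale0r (0 : 'cV[R]_4)) dotZl mul0r.
  by rewrite !d0; ring.
have D := quat_frame_dots u.
have n0 : dot u u != 0 by rewrite gt_eqF // G_pos.
pose f x y := T u (A *m x) y + T u x (A *m y) - (t (A *m x) * dot u y
  - t y * dot u (A *m x) + t x * dot u (A *m y) - t (A *m y) * dot u x).
suff : f v w = 0 by rewrite /f; lra.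
have flin1 y : scalar_form (f^~ y).
  move=> a x z; rewrite /f !mulmxDr -!scalemxAr !dotDr !dotZr !t_lin.
  by rewrite !T_lin2; ring.
have flin2 x : scalar_form (f x).
  move=> a y z; rewrite /f !mulmxDr -!scalemxAr !dotDr !dotZr !t_lin.
  by rewrite !T_lin3; ring.
have H1 := torsion_in_frame u0 t_A; have H2 := torsion_in_frame u0 t_B.
have H3 := torsion_in_frame u0 t_C.
rewrite !big_ord_recl !big_ord0 /quat_frame /= ?mulmxA ?m in H1 H2 H3.
have {}H1 := H1 erefl; have {}H2 := H2 erefl; have {}H3 := H3 erefl.
rewrite !mulNmx !mul1mx !TNr ?T112 ?T121 ?T122 in H1 H2 H3.
rewrite (T_skew23 u (C *m u)) in H1; rewrite (T_skew23 u (A *m u)) in H2.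
rewrite (T_skew23 u (B *m u)) in H3.
have K1 : T u (B *m u) (C *m u) = - dot u u * t (A *m u) by lra.
have K2 : T u (C *m u) (A *m u) = - dot u u * t (B *m u) by lra.
have K3 : T u (A *m u) (B *m u) = - dot u u * t (C *m u) by lra.
have K1' := T_skew23 u (C *m u) (B *m u); rewrite K1 in K1'.
have K2' := T_skew23 u (A *m u) (C *m u); rewrite K2 in K2'.
have K3' := T_skew23 u (B *m u) (A *m u); rewrite K3 in K3'.
have tN x : t (- x) = - t x by exact: scalar_formN.
have ff i j : f (quat_frame u i) (quat_frame u j) = 0.
  case: i => [[|[|[|[|//]]]] ?]; case: j => [[|[|[|[|//]]]] ?];
  rewrite /f /quat_frame /= ?mulmxA ?m ?mulNmx ?mul1mx ?TNm ?TNr ?dotNr ?tN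
    ?T112 ?T121 ?T122 ?K1 ?K2 ?K3 ?K1' ?K2' ?K3' ?D; ring.
have He := quat_frame_orthonormal u0.
apply: (scalar_form_eq0 v (flin1 w) He) => i.
apply: (scalar_form_eq0 w (flin2 _) He) => j.
by rewrite (scalar_formZ _ _ (flin1 _)) (scalar_formZ _ _ (flin2 _)) ff !mulr0.
Qed.

(** The difference [D] between the Weyl connection and the metric connection
    with torsion [T] commutes with the triple.  The hypotheses on [D] are the
    ones of the Koszul formula. *)
Lemma difference_commutes (D : 'cV[R]_4 -> 'M[R]_4) :
  (forall u v w, dot (D u *m v) w + dot v (D u *m w) = t u * dot v w) ->
  (forall u v w, dot (D u *m v) w - dot (D v *m u) w = - T u v w) ->
  forall u, A *m D u = D u *m A.
Proof.
move=> Dmet Dtor u.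
have koszul a b c : 2 * dot (D a *m b) c =
    t a * dot b c + t b * dot a c - t c * dot a b - T a b c.
  have met x y z : dot (D x *m y) z + dot (D x *m z) y = t x * dot y z.
    by rewrite -Dmet (dotC y).
  have := met a b c; have := met b a c; have := met c a b.
  have := Dtor a b c; have := Dtor b c a; have := Dtor a c b.
  rewrite (T_skew23 a c b) (T_skew23 b c a) (T_skew12 b a c); lra.
have m := qtriple_mul q.
have vec_eq (v : 'cV[R]_4) : (A *m D u) *m v = (D u *m A) *m v.
  apply/eqP; rewrite -subr_eq0; apply/eqP; apply: dot_nondegenerate => w.
  rewrite dotDl dotNl -!mulmxA dot_skew_unit ?m //.
  have := koszul u (A *m v) w; have := koszul u v (A *m w).
  have := torsion_commutator u v w.
  have := dot_skew_unit v w m.1.1.1.1.1.1.1.1 A_orth.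
  rewrite -?mulmxA => ->; lra.
exact: mulmx_vec_inj vec_eq.
Qed.

End quaternionic_frame.

End inner_product.

(** * Connections in a chart *)

Lemma mxDE (R : realType) m n (A B : 'M[R]_(m, n)) i j : (A + B) i j = A i j + B i j.
Proof. by rewrite mxE. Qed.

Lemma mxNE (R : realType) m n (A : 'M[R]_(m, n)) i j : (- A) i j = - A i j.
Proof. by rewrite mxE. Qed.

Lemma mx0E (R : realType) m n i j : (0 : 'M[R]_(m, n)) i j = 0.
Proof. by rewrite mxE. Qed.

(* Identities of additive groups between matrix expressions, entry by entry,  *)
(* with products as atoms.                                                    *)
Ltac mx_abelian :=
  rewrite ?(mulmxDl, mulmxBl, mulmxDr, mulmxBr, mulNmx, mulmxN) ?mulmxA;
  apply/matrixP => ? ?; rewrite ?(mxDE, mxNE, mx0E); ring.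

Lemma gamma_of_linear (R : realType) (G : 'I_4 -> coord R -> 'M[R]_4) x :
  linear (gamma_of G x).
Proof.
move=> a u v; rewrite /gamma_of scaler_sumr -big_split /=; apply: eq_bigr => i _.
by rewrite !mxE scalerDl scalerA.
Qed.

Lemma is_derive_gamma_of (R : realType) (G : 'I_4 -> coord R -> 'M[R]_4)
    (a : coord R -> coord R) x u da :
  is_derive x u a da -> (forall i, derivable (G i) x u) ->
  is_derive x u (fun y => gamma_of G y (a y))
    (gamma_of G x da + \sum_(i < 4) a x i 0 *: 'D_u (G i) x).
Proof.
move=> Ha HG; rewrite /gamma_of -big_split /=; apply: is_derive_bigsum => i.
have Hi : is_derive x u (G i) ('D_u (G i) x) by exact: derivableP (HG i).
exact: is_derive_scale (is_derive_entry i 0 Ha) Hi.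
Qed.

Section connection_calculus.
Variables (R : realType) (M : manifold4 R) (N : connection M) (c : chart R M).
Hypothesis hc : atlas c.

Lemma christoffel_derivable i x u : img c x -> derivable (christoffel N c i) x u.
Proof. by move=> hx; apply: smooth_derivable (christoffel_smooth N i hc) hx. Qed.

Lemma gamma_linear x : linear (gamma N c x).
Proof. exact: gamma_of_linear. Qed.

Lemma gamma0 x : gamma N c x 0 = 0.
Proof.
by rewrite /gamma /gamma_of big1 // => i _; rewrite mxE scale0r.
Qed.

(** The derivative in the direction [u] of the connection matrix of [v]. *)
Definition dgamma (x u v : coord R) : 'M[R]_4 :=
  \sum_(i < 4) v i 0 *: 'D_u (christoffel N c i) x.

Lemma is_derive_gamma x u v : img c x ->
  is_derive x u (fun y => gamma N c y v) (dgamma x u v).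
Proof.
move=> hx; have := @is_derive_gamma_of _ (christoffel N c) (cst v) x u 0
  (is_derive_cst _ _ _) (fun i => christoffel_derivable hx).
by rewrite -/(gamma N c x 0) gamma0 add0r.
Qed.

(** The curvature endomorphism, as a matrix. *)
Definition curv_mx (x u v : coord R) : 'M[R]_4 :=
  dgamma x u v - dgamma x v u
  + gamma N c x u *m gamma N c x v - gamma N c x v *m gamma N c x u.

Lemma cov_cst x u v :
  cov N c (cst u) (cst v) x = gamma N c x u *m v.
Proof. by rewrite /cov derive_cst add0r. Qed.

Lemma bracket_cst (u v : coord R) : bracket (cst u) (cst v) = cst 0.
Proof. by apply/funext => x; rewrite /bracket !derive_cst subrr. Qed.

Lemma torsionE x u v :
  torsion N c x u v = gamma N c x u *m v - gamma N c x v *m u.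
Proof. by rewrite /torsion /torsion_field !cov_cst bracket_cst subr0. Qed.

Lemma curvatureE x u v w : img c x ->
  curvature N c x u v w = curv_mx x u v *m w.
Proof.
move=> hx; rewrite /curvature /curvature_field bracket_cst cov_cst gamma0 mul0mx subr0.
have E a b : cov N c (cst a) (cov N c (cst b) (cst w)) x =
    dgamma x a b *m w + gamma N c x a *m gamma N c x b *m w.
  rewrite {1}/cov cov_cst mulmxA; congr (_ + _).
  have -> : cov N c (cst b) (cst w) = fun y => gamma N c y b *m w.
    by apply/funext => y; rewrite cov_cst.
  by have [_ ->] := is_derive_mulmx_cst w (is_derive_gamma a b hx).
rewrite !E /curv_mx.
move: (gamma N c x u) (gamma N c x v) (dgamma x u v) (dgamma x v u) => P Q P' Q'.
mx_abelian.
Qed.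

Lemma curv_mx_skew x u v : curv_mx x u v = - curv_mx x v u.
Proof.
rewrite /curv_mx.
move: (gamma N c x u) (gamma N c x v) (dgamma x u v) (dgamma x v u) => P Q P' Q'.
mx_abelian.
Qed.

Lemma curv_mx_linear x u : img c x -> linear (curv_mx x u).
Proof.
move=> hx a v w.
have dl : dgamma x u (a *: v + w) = a *: dgamma x u v + dgamma x u w.
  rewrite /dgamma scaler_sumr -big_split /=; apply: eq_bigr => i _.
  by rewrite !mxE scalerDl scalerA.
have dr : dgamma x (a *: v + w) u = a *: dgamma x v u + dgamma x w u.
  rewrite /dgamma scaler_sumr -big_split /=; apply: eq_bigr => i _.
  have df : differentiable (christoffel N c i) x.
    exact: smooth_on_differentiable (christoffel_smooth N i hc) hx.
  by rewrite (derive_linear df) scalerDr !scalerA mulrC.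
rewrite /curv_mx dl dr gamma_linear mulmxDr mulmxDl -scalemxAr -scalemxAl.
move: (gamma N c x u) (gamma N c x v) (gamma N c x w) => P Q S.
move: (dgamma x u v) (dgamma x v u) (dgamma x u w) (dgamma x w u) => P' Q' P1 S'.
rewrite !(scalerDr, scalerN).
move: (a *: _) (a *: _) (a *: (P *m Q)) (a *: (Q *m P)) => X Y Z T.
mx_abelian.
Qed.

Lemma torsion_free_bianchi x u v w : img c x -> torsion_free N ->
  curv_mx x u v *m w + curv_mx x v w *m u + curv_mx x w u *m v = 0.
Proof.
move=> hx tf.
have oi : open (img c) by exact: img_open.
have gs y a b : img c y -> gamma N c y a *m b = gamma N c y b *m a.
  by move=> hy; apply/eqP; rewrite -subr_eq0 -torsionE tf.
have ds a b d : dgamma x a b *m d = dgamma x a d *m b.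
  have D p (q : coord R) : is_derive x a (fun y => gamma N c y p *m q) (dgamma x a p *m q).
    exact: is_derive_mulmx_cst (is_derive_gamma a p hx).
  have [_ <-] := D b d; have [_ <-] := D d b.
  by apply: near_eq_derive; apply: (near_open oi hx) => y; apply: gs.
move: (ds v u w) (ds w v u) (ds u w v) (gs x w v hx) (gs x u w hx) (gs x v u hx).
rewrite /curv_mx.
move: (gamma N c x u) (gamma N c x v) (gamma N c x w) => P Q S.
move: (dgamma x u v) (dgamma x v u) (dgamma x u w) (dgamma x w u) (dgamma x v w)
  (dgamma x w v) => P1 P2 P3 P4 P5 P6 E1 E2 E3 F1 F2 F3.
rewrite !(mulmxDl, mulmxBl, mulNmx) -!mulmxA E1 E2 E3 F1 F2 F3.
mx_abelian.
Qed.

Lemma covEndE (A : coord R -> 'M[R]_4) x u :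
  covEnd N c A x u = 'D_u A x + gamma N c x u *m A x - A x *m gamma N c x u.
Proof. by []. Qed.

Lemma covEnd_local (U : set (coord R)) (A B : coord R -> 'M[R]_4) x u :
  open U -> U x -> (forall y, U y -> A y = B y) -> covEnd N c A x u = covEnd N c B x u.
Proof.
move=> oU Ux E.
have D : 'D_u A x = 'D_u B x by exact: near_eq_derive (near_open oU Ux E).
by rewrite !covEndE D (E x Ux).
Qed.

Lemma is_derive_covEnd (U : set (coord R)) (F : coord R -> 'M[R]_4) x u v :
  U `<=` img c -> smooth_on U F -> U x ->
  is_derive x u (fun y => covEnd N c F y v)
   ('D_u ('D_v F) x + (dgamma x u v *m F x + gamma N c x v *m 'D_u F x)
     - ('D_u F x *m gamma N c x v + F x *m dgamma x u v)).
Proof.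
move=> Uc sF Ux; have hx := Uc _ Ux.
have dF : is_derive x u F ('D_u F x).
  by apply: derivableP; apply: smooth_derivable sF Ux.
have ddF : is_derive x u ('D_v F) ('D_u ('D_v F) x).
  by apply: derivableP; apply: smooth_derivable (smooth_on_derive v sF) Ux.
have dG := is_derive_gamma u v hx.
exact: is_deriveB (is_deriveD ddF (is_derive_mulmx dG dF)) (is_derive_mulmx dF dG).
Qed.

(** The Ricci identity: the commutator of two covariant derivatives of a field
    of endomorphisms is the commutator with the curvature. *)
Lemma ricci_identity (U : set (coord R)) (F : coord R -> 'M[R]_4) x u v :
  open U -> U `<=` img c -> smooth_on U F -> U x ->
  covEnd N c (fun y => covEnd N c F y v) x u
  - covEnd N c (fun y => covEnd N c F y u) x v =
  curv_mx x u v *m F x - F x *m curv_mx x u v.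
Proof.
move=> oU Uc sF Ux.
have [_ E1] := is_derive_covEnd u v Uc sF Ux.
have [_ E2] := is_derive_covEnd v u Uc sF Ux.
rewrite (covEndE (fun y => covEnd N c F y v)) (covEndE (fun y => covEnd N c F y u)) E1 E2.
rewrite (schwarz_mx v u oU sF Ux) /covEnd /curv_mx.
move: (gamma N c x u) (gamma N c x v) (dgamma x u v) (dgamma x v u) => P Q P' Q'.
move: ('D_u F x) ('D_v F x) ('D_u _ x) (F x) => Fu Fv Fuv F0.
mx_abelian.
Qed.

End connection_calculus.

(** * Change of charts *)

Lemma overlap_open (R : realType) (M : manifold4 R) (c d : chart R M) :
  open (overlap c d).
Proof.
rewrite openE => x [cx dx].
have oc : nbhs x (img c) by apply: open_nbhs_nbhs; split => //; exact: img_open.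
have od : nbhs (psi c x) (dom d) by apply: open_nbhs_nbhs; split => //; exact: dom_open.
exact: filterI oc (psi_continuous cx od).
Qed.

(** The Jacobian matrix, acting on columns from the left. *)
Definition jac (R : realType) (f : coord R -> coord R) (x : coord R) : 'M[R]_4 :=
  \matrix_(i < 4, k < 4) ('D_(delta_mx k 0) f x) i 0.

Lemma jacE (R : realType) (f : coord R -> coord R) x u :
  differentiable f x -> jac f x *m u = 'D_u f x.
Proof.
move=> df; rewrite deriveE // [u in RHS]matrix_sum_delta linear_sum.
apply/matrixP => i j; rewrite ord1 summxE mxE; apply: eq_bigr => k _.
by rewrite big_ord1 linearZ /= mxE [RHS]mxE mulrC deriveE.
Qed.

Section chart_change.
Variables (R : realType) (M : manifold4 R) (N : connection M) (c d : chart R M).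
Hypotheses (hc : atlas c) (hd : atlas d).
Let tau := trans c d.
Let O := overlap c d.

Let O_open : open O. Proof. exact: overlap_open. Qed.
Let tau_smooth : smooth_on O tau. Proof. exact: atlas_smooth. Qed.
Let tau_diff y : O y -> differentiable tau y.
Proof. by move=> Oy; apply: smooth_on_differentiable tau_smooth Oy. Qed.

Lemma trans_img y : O y -> img d (tau y).
Proof. by case=> _ dy; exists (psi c y). Qed.

Lemma overlap_img y : O y -> img c y.
Proof. by case. Qed.

Lemma is_derive_jac y u : O y -> is_derive y u (jac tau) ('D_u (jac tau) y).
Proof.
move=> Oy; apply: derivableP; apply/derivable_mxP => i k.
have -> : (fun x => jac tau x i k) = (fun x => ('D_(delta_mx k 0) tau x) i 0).
  by apply/funext => x; rewrite mxE.
have dk := smooth_derivable (v := u) (smooth_on_derive (delta_mx k 0) tau_smooth) Oy.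
by have [] := is_derive_entry i 0 (derivableP dk).
Qed.

Lemma derive_jac y u w : O y -> 'D_u (jac tau) y *m w = 'D_u ('D_w tau) y.
Proof.
move=> Oy; have [_ <-] := is_derive_mulmx_cst w (is_derive_jac u Oy).
by apply: near_eq_derive; apply: (near_open O_open Oy) => z /tau_diff; exact: jacE.
Qed.

Lemma derive_jac_sym y u w : O y ->
  'D_u (jac tau) y *m w = 'D_w (jac tau) y *m u.
Proof.
move=> Oy; apply: etrans (derive_jac u w Oy) _; apply: etrans (esym (derive_jac w u Oy)).
exact: schwarz_mx O_open tau_smooth Oy.
Qed.

(** The transformation law of the Christoffel symbols, solved for the derivative of
    the Jacobian. *)
Lemma christoffel_change y u : O y ->
  'D_u (jac tau) y =
  jac tau y *m gamma N c y u - gamma N d (tau y) (jac tau y *m u) *m jac tau y.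
Proof.
move=> Oy; apply: mulmx_vec_inj => w.
have E := christoffel_trans N hc hd Oy u w; rewrite /= -/tau in E.
rewrite mulmxBl -!mulmxA !jacE; try exact: tau_diff.
by rewrite E derive_jac // addrK.
Qed.

(** Differentiating the transformation law of the Christoffel symbols once more,
    the symmetry of the third derivatives of the transition map shows that the
    curvature is a tensor. *)
Lemma curv_mx_change x u v : O x ->
  jac tau x *m curv_mx N c x u v =
  curv_mx N d (tau x) (jac tau x *m u) (jac tau x *m v) *m jac tau x.
Proof.
move=> Ox; apply: mulmx_vec_inj => w.
pose A := jac tau.
have dgd i p : derivable (christoffel N d i \o tau) x p.
  apply: diff_derivable; apply: differentiable_comp; first exact: tau_diff.
  exact: smooth_on_differentiable (christoffel_smooth N i hd) (trans_img Ox).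
have DG' p q : is_derive x p (fun y => gamma N d (tau y) (A y *m q))
    (gamma N d (tau x) ('D_p A x *m q) + dgamma N d (tau x) (A x *m p) (A x *m q)).
  have Ha : is_derive x p (fun y => A y *m q) ('D_p A x *m q).
    exact: is_derive_mulmx_cst (is_derive_jac p Ox).
  apply: is_derive_eq
    (@is_derive_gamma_of _ (fun i => christoffel N d i \o tau) _ x p _ Ha (dgd^~ p)) _.
  apply: (congr1 (fun Z => _ + Z)); apply: eq_bigr => i _; congr (_ *: _).
  have [_ ->] := @is_derive_comp_dir _ _ _ _ tau (christoffel N d i) x p (tau_diff Ox)
    (smooth_on_differentiable (christoffel_smooth N i hd) (trans_img Ox)).
  by rewrite /A jacE //; exact: tau_diff.
have DD p q : 'D_p ('D_q ('D_w tau)) x =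
   ('D_p A x *m gamma N c x q + A x *m dgamma N c x p q
   - ((gamma N d (tau x) ('D_p A x *m q) + dgamma N d (tau x) (A x *m p) (A x *m q)) *m A x
     + gamma N d (tau x) (A x *m q) *m 'D_p A x)) *m w.
  have D1 := is_derive_mulmx (is_derive_jac p Ox) (is_derive_gamma N hc p q (overlap_img Ox)).
  have D2 := is_derive_mulmx (DG' p q) (is_derive_jac p Ox).
  have [_ <-] := is_derive_mulmx_cst w (is_deriveB D1 D2).
  apply: near_eq_derive; apply: (near_open O_open Ox) => y Oy.
  by rewrite -derive_jac // christoffel_change.
have sch := schwarz_mx u v O_open (smooth_on_derive w tau_smooth) Ox.
move: (etrans (esym (DD v u)) (etrans sch (DD u v))).
move: (derive_jac_sym v u Ox) (christoffel_change u Ox) (christoffel_change v Ox).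
rewrite /curv_mx -/A.
move: (A x) ('D_u A x) ('D_v A x) (gamma N c x u) (gamma N c x v) => J Ju Jv P Q.
move: (dgamma N c x u v) (dgamma N c x v u) => P' Q'.
move: (gamma N d (tau x)) (dgamma N d (tau x)) => G G' sym.
rewrite sym; move: (G (Ju *m v)) (G (J *m u)) (G (J *m v)) => Z S T.
move: (G' (J *m u) (J *m v)) (G' (J *m v) (J *m u)) => S' T' -> ->.
move=> /eqP; rewrite -subr_eq0 => /eqP E.
apply/eqP; rewrite -subr_eq0; apply/eqP; rewrite -oppr0 -E.
mx_abelian.
Qed.

End chart_change.

Lemma mx_of_linear (R : realType) (f : coord R -> coord R) (u : coord R) :
  linear f -> (\matrix_(i < 4, k < 4) f (delta_mx k 0) i 0) *m u = f u.
Proof.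
move=> lf.
pose L : {linear coord R -> coord R} := HB.pack f (GRing.isLinear.Build _ _ _ _ f lf).
rewrite -[f u]/(L u) [u in RHS]matrix_sum_delta linear_sum.
apply/matrixP => i j; rewrite ord1 summxE mxE; apply: eq_bigr => k _.
by rewrite big_ord1 linearZ mxE [RHS]mxE mulrC.
Qed.

Lemma kernel0_unitmx (R : realType) (A : 'M[R]_4) :
  (forall u : coord R, A *m u = 0 -> u = 0) -> A \in unitmx.
Proof.
move=> H; rewrite -unitmx_tr -row_free_unit -kermx_eq0; apply/eqP/row_matrixP => i.
rewrite row0; apply: trmx_inj; rewrite trmx0; apply: H.
by apply: trmx_inj; rewrite trmx_mul trmxK trmx0 -row_mul mulmx_ker row0.
Qed.

(** Curvature tensors that correspond to each other under the change of basis [A]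
    have corresponding Ricci tensors: the endomorphisms whose traces define them
    are conjugate. *)
Lemma trace_ric_change (R : realType) (A : 'M[R]_4)
    (K K' : coord R -> coord R -> 'M[R]_4) v w :
  A \in unitmx ->
  (forall z, linear (K^~ z)) -> (forall z, linear (K'^~ z)) ->
  (forall a b, A *m K a b = K' (A *m a) (A *m b) *m A) ->
  trace_ric K' (A *m v) (A *m w) = trace_ric K v w.
Proof.
move=> uA lK lK' E.
pose L := \matrix_(i < 4, k < 4) (K (delta_mx k 0) v *m w) i 0.
pose L' := \matrix_(i < 4, k < 4) (K' (delta_mx k 0) (A *m v) *m (A *m w)) i 0.
have tL : trace_ric K v w = \tr L by apply: eq_bigr => i _; rewrite [RHS]mxE.
have tL' : trace_ric K' (A *m v) (A *m w) = \tr L'.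
  by apply: eq_bigr => i _; rewrite [RHS]mxE.
have LL : L' *m A = A *m L.
  apply: mulmx_vec_inj => z; rewrite -!mulmxA.
  rewrite (@mx_of_linear _ (fun z => K' z (A *m v) *m (A *m w))); last first.
    by move=> a p r; rewrite lK' mulmxDl -scalemxAl.
  rewrite (@mx_of_linear _ (fun z => K z v *m w)); last first.
    by move=> a p r; rewrite lK mulmxDl -scalemxAl.
  by rewrite !mulmxA E.
by rewrite tL tL' -[L'](mulmxK uA) LL mxtrace_mulC mulKmx.
Qed.

Lemma curv_mx_linear_l (R : realType) (M : manifold4 R) (N : connection M)
    (c : chart R M) x z : atlas c -> img c x -> linear ((curv_mx N c x)^~ z).
Proof.
move=> hc hx a u v; rewrite !(curv_mx_skew _ _ _ _ z) curv_mx_linear //.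
by rewrite opprD scalerN.
Qed.

Lemma ricciE (R : realType) (M : manifold4 R) (N : connection M)
    (c : chart R M) x v w : atlas c -> img c x ->
  ricci N c x v w = trace_ric (curv_mx N c x) v w.
Proof. by move=> hc hx; apply: eq_bigr => i _; rewrite curvatureE. Qed.

Section chart_change_metric.
Variables (R : realType) (M : manifold4 R) (N : connection M) (g : riem_metric M).
Variables (c d : chart R M).
Hypotheses (hc : atlas c) (hd : atlas d).

Lemma gdot_change x u v : overlap c d x ->
  gdot g d (trans c d x) (jac (trans c d) x *m u) (jac (trans c d) x *m v) =
  gdot g c x u v.
Proof.
move=> Ox; have df : differentiable (trans c d) x.
  exact: smooth_on_differentiable (atlas_smooth hc hd) Ox.
by rewrite !jacE // /gdot (gram_trans g hc hd Ox).
Qed.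

(** The metrics of the two charts correspond to each other and are definite, so the
    Jacobian has no kernel. *)
Lemma jac_unitmx x : overlap c d x -> jac (trans c d) x \in unitmx.
Proof.
move=> Ox; apply: kernel0_unitmx => u Au; apply/eqP/negPn/negP => u0.
have := gram_pos g hc (overlap_img Ox) u0.
by rewrite -/(gdot g c x u u) -gdot_change // Au /gdot mulmx0 mxE ltxx.
Qed.

Lemma ricci_change x v w : overlap c d x ->
  ricci N d (trans c d x) (jac (trans c d) x *m v) (jac (trans c d) x *m w) =
  ricci N c x v w.
Proof.
move=> Ox; have hx := overlap_img Ox; have hy := trans_img Ox.
rewrite !ricciE //; apply: trace_ric_change => [|z|z|a b].
- exact: jac_unitmx.
- exact: curv_mx_linear_l.
- exact: curv_mx_linear_l.
- exact: curv_mx_change.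
Qed.

End chart_change_metric.

(** A point may lie in several charts; the conformal factor of the symmetrised
    Ricci tensor does not depend on the chart. *)
Lemma einstein_factor_unique (R : realType) (M : manifold4 R) (N : connection M)
    (g : riem_metric M) (c d : chart R M) x y (l l' : R) :
  atlas c -> atlas d -> img c x -> img d y -> psi c x = psi d y ->
  (forall u v, Sym (ricci N c x) u v = l * gdot g c x u v) ->
  (forall u v, Sym (ricci N d y) u v = l' * gdot g d y u v) -> l = l'.
Proof.
move=> hc hd hx hy xy Hl Hl'.
have [p dp py] := hy.
have yE : psi d y = p by rewrite -py phiK.
have Ox : overlap c d x by split => //; rewrite xy yE.
have ty : trans c d x = y by rewrite /trans xy yE.
pose u : coord R := delta_mx 0 0.
have u0 : u != 0 by apply/eqP => /matrixP /(_ 0 0); rewrite !mxE /= => /eqP; rewrite oner_eq0.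
have gu : 0 < gdot g c x u u by exact: gram_pos.
have := Hl' (jac (trans c d) x *m u) (jac (trans c d) x *m u).
rewrite -ty gdot_change // /Sym ricci_change // -/(Sym (ricci N c x) u u) Hl.
by apply: mulIf; rewrite gt_eqF.
Qed.

(** * The two connections along the quaternionic structure *)

Lemma sum3 (V : nmodType) (F : 'I_3 -> V) :
  \sum_(a < 3) F a = F 0 + F 1 + F 2.
Proof.
rewrite !big_ord_recl big_ord0 addr0 addrA; congr (_ + F _ + F _); exact: val_inj.
Qed.

Lemma forall3 (P : 'I_3 -> Prop) : P 0 -> P 1 -> P 2 -> forall a, P a.
Proof.
move=> P0 P1 P2 [[|[|[|//]]] ha].
- by rewrite (_ : Ordinal ha = 0); [|apply: val_inj].
- by rewrite (_ : Ordinal ha = 1); [|apply: val_inj].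
- by rewrite (_ : Ordinal ha = 2); [|apply: val_inj].
Qed.

Section span.
Variables (R : realType) (J : 'I_3 -> 'M[R]_4).

Lemma span3_gen a : span3 J (J a).
Proof.
exists (fun b => (b == a)%:R); rewrite (bigD1 a) //= eqxx scale1r big1 ?addr0 //.
by move=> b /negbTE ->; rewrite scale0r.
Qed.

Lemma span3D A B : span3 J A -> span3 J B -> span3 J (A + B).
Proof.
move=> [a ->] [b ->]; exists (fun i => a i + b i).
by rewrite -big_split /=; apply: eq_bigr => i _; rewrite scalerDl.
Qed.

Lemma span3Z k A : span3 J A -> span3 J (k *: A).
Proof.
move=> [a ->]; exists (fun i => k * a i).
by rewrite scaler_sumr; apply: eq_bigr => i _; rewrite scalerA.
Qed.

Lemma span3_sum I (s : seq I) F : (forall i, span3 J (F i)) ->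
  span3 J (\sum_(i <- s) F i).
Proof.
move=> H; elim/big_ind: _ => // [|A B]; last exact: span3D.
by rewrite -(scale0r (J 0)); apply/span3Z/span3_gen.
Qed.

Lemma span3_commuting (X : 'M[R]_4) A :
  (forall a, J a *m X = X *m J a) -> span3 J A -> A *m X = X *m A.
Proof.
move=> H [a ->]; rewrite mulmx_suml mulmx_sumr; apply: eq_bigr => i _.
by rewrite -scalemxAl H scalemxAr.
Qed.

Lemma quaternionic_triple_qtriple :
  quaternionic_triple J -> qtriple (J 0) (J 1) (J 2).
Proof. by case=> H1 H2 H3; split. Qed.

(** The units are orthogonal for the trace form, which gives the coordinates of an
    element of their span. *)
Lemma span3_coord A : quaternionic_triple J -> span3 J A ->
  A = \sum_(b < 3) (- 4^-1 * \tr (J b *m A)) *: J b.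
Proof.
move=> /quaternionic_triple_qtriple q [a ->]; have m := qtriple_mul q.
have tC := qtriple_tr0 q; have tA := qtriple_tr0 (qtriple_rot q).
have tB := qtriple_tr0 (qtriple_rot (qtriple_rot q)).
have t1 : \tr (- 1%:M : 'M[R]_4) = - 4%:R by rewrite raddfN /= mxtrace1.
set S := \sum_(i < 3) a i *: J i.
suff H b : a b = - 4^-1 * \tr (J b *m S) by apply: eq_bigr => b _; rewrite -H.
rewrite {}/S sum3; move: b; apply: forall3;
  rewrite !mulmxDr -!scalemxAr !m !mxtraceD !mxtraceZ ?t1 ?raddfN /= ?tA ?tB ?tC; by field.
Qed.

End span.

Lemma is_derive_trace (R : realType) (V : normedModType R) n
    (A : V -> 'M[R]_n) (x v : V) dA :
  is_derive x v A dA -> is_derive x v (fun y => \tr (A y)) (\tr dA).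
Proof. by move=> HA; apply: is_derive_bigsum => i; exact: is_derive_entry. Qed.

Section weyl_and_qkt.
Variables (R : realType) (M : manifold4 R) (Q : almost_quaternionic M).
Variables (g : riem_metric M) (nabla : connection M) (t : oneform M).
Variable (W : connection M).
Hypotheses (hQKT : QKT Q g nabla) (ht : is_torsion_oneform Q g nabla t).
Hypothesis hW : is_weyl g t W.

Variables (c : chart R M) (U : set (coord R)) (J : 'I_3 -> coord R -> 'M[R]_4).
Hypotheses (hc : atlas c) (hJ : admissible c (fiber Q c) U J).

Let U_open : open U. Proof. by case: hJ. Qed.
Let U_img : U `<=` img c. Proof. by case: hJ. Qed.
Let J_smooth a : smooth_on U (J a). Proof. by case: hJ. Qed.
Let J_triple x : U x -> quaternionic_triple (J ^~ x).
Proof. by case: hJ => _ _ _ H /H []. Qed.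
Let J_fiber x : U x -> fiber Q c x = span3 (J ^~ x).
Proof. by case: hJ => _ _ _ H /H []. Qed.

Lemma admissible_orthogonal x a u v : U x ->
  gdot g c x (J a x *m u) (J a x *m v) = gdot g c x u v.
Proof.
move=> Ux; case: hQKT => herm _ _ _ _; apply: herm => //; first exact: U_img.
  by rewrite J_fiber //; exact: (@span3_gen _ (J^~ x)).
by case: (J_triple Ux).
Qed.

(** The Weyl connection and the connection with torsion differ by endomorphisms
    that commute with the quaternionic structure. *)
Lemma weyl_difference_commutes x a u : U x ->
  J a x *m (gamma W c x u - gamma nabla c x u) =
  (gamma W c x u - gamma nabla c x u) *m J a x.
Proof.
move=> Ux; have hx := U_img Ux.
case: hQKT => _ met _ skew _; case: hW => tf wmet.
have Gs := gram_sym g hc hx.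
have Gp (z : coord R) : z != 0 -> 0 < (z^T *m gram g c x *m z) 0 0.
  exact: gram_pos.
have q := quaternionic_triple_qtriple (J_triple Ux).
have orth b z w : dot (gram g c x) (J b x *m z) (J b x *m w) = dot (gram g c x) z w.
  exact: admissible_orthogonal.
pose D z := gamma W c x z - gamma nabla c x z.
pose T := torsion3 g nabla c x.
have TE z v w : T z v w = dot (gram g c x) (gamma nabla c x z *m v - gamma nabla c x v *m z) w.
  by rewrite /T /torsion3 torsionE.
have tl : scalar_form (oneform_at t c x).
  by move=> k z w; rewrite /oneform_at mulmxDr -scalemxAr !mxE.
have T1 v w : scalar_form (fun z => T z v w).
  move=> k z y; rewrite !TE gamma_linear mulmxDl mulmxDr -scalemxAl -scalemxAr.
  rewrite -dotZl // -dotDl // scalerBr; congr (dot _ _ _).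
  by rewrite opprD addrACA.
have sk1 z v w : T z v w = - T v z w by case: (skew c x hc hx z v w).
have sk2 z v w : T z v w = - T z w v by case: (skew c x hc hx z v w).
have T2 z w : scalar_form (fun v => T z v w).
  by move=> k v y; rewrite !(sk1 z) T1 opprD mulrN.
have T3 z v : scalar_form (T z v).
  by move=> k w y; rewrite TE dotDr // dotZr // -!TE.
have lee b : forall e z, is_orthonormal (gram g c x) e ->
    oneform_at t c x z = 2^-1 * \sum_(i < 4) T (J b x *m z) (e i) (J b x *m e i).
  move=> e z He; rewrite (ht hc hJ Ux He b z) /torsion_oneform_local.
  by rewrite mulNr opprK.
have Dmet z v w : dot (gram g c x) (D z *m v) w + dot (gram g c x) v (D z *m w) =
    oneform_at t c x z * dot (gram g c x) v w.
  have gd a1 a2 : gdot g c x a1 a2 = dot (gram g c x) a1 a2 by [].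
  have h1 := met c x hc hx z v w; have h2 := wmet c x hc hx z v w.
  rewrite /cov_metric !cov_cst !gd in h1 h2.
  rewrite /D !mulmxBl !dotDl // !dotDr // !dotNl // !dotNr //.
  move: h1 h2; move: ('D_z _ x) (dot _ _ _) (dot _ _ _) (dot _ _ _) (dot _ _ _).
  move=> r1 r2 r3 r4 r5; lra.
have Dtor z v w : dot (gram g c x) (D z *m v) w - dot (gram g c x) (D v *m z) w = - T z v w.
  have := tf c x hc hx z v; rewrite torsionE => /eqP; rewrite subr_eq0 => /eqP E.
  rewrite TE /D !mulmxBl E !dotDl // !dotNl //; ring.
have q1 := qtriple_rot q; have q2 := qtriple_rot q1.
move: a; apply: forall3.
- exact: (difference_commutes Gs Gp q (orth 0) (orth 1) (orth 2) tl T1 T2 T3 sk1 sk2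
    (lee 0) (lee 1) (lee 2) Dmet Dtor).
- exact: (difference_commutes Gs Gp q1 (orth 1) (orth 2) (orth 0) tl T1 T2 T3 sk1 sk2
    (lee 1) (lee 2) (lee 0) Dmet Dtor).
- exact: (difference_commutes Gs Gp q2 (orth 2) (orth 0) (orth 1) tl T1 T2 T3 sk1 sk2
    (lee 2) (lee 0) (lee 1) Dmet Dtor).
Qed.

(** On sections of the quaternionic bundle the two connections agree. *)
Lemma covEnd_weyl (A : coord R -> 'M[R]_4) x u : U x -> span3 (J ^~ x) (A x) ->
  covEnd W c A x u = covEnd nabla c A x u.
Proof.
move=> Ux hA; have := span3_commuting (fun a => weyl_difference_commutes a u Ux) hA.
rewrite !covEndE mulmxBr mulmxBl.
move: ('D_u A x) (gamma W c x u) (gamma nabla c x u) (A x) => X P S Y.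
move=> /eqP; rewrite -subr_eq0 => /eqP E; apply/eqP; rewrite -subr_eq0; apply/eqP.
rewrite -oppr0 -E; mx_abelian.
Qed.

Lemma covEnd_unit_span x a u : U x -> span3 (J ^~ x) (covEnd nabla c (J a) x u).
Proof.
move=> Ux; rewrite -J_fiber //; case: hQKT => _ _ quat _ _.
apply: (quat c hc U) => // y Uy; rewrite J_fiber //.
exact: (@span3_gen _ (J^~ y)).
Qed.

(** A second covariant derivative of a unit is a section of [Q], because the
    coordinates of the first one in the admissible basis are differentiable. *)
Lemma covEnd2_unit_span x a u v : U x ->
  span3 (J ^~ x) (covEnd nabla c (fun y => covEnd nabla c (J a) y v) x u).
Proof.
move=> Ux.
(* The coordinates of the first covariant derivative, from span3_coord.       *)
pose om b y := - 4^-1 * \tr (J b y *m covEnd nabla c (J a) y v).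
have E y : U y -> covEnd nabla c (J a) y v = \sum_(b < 3) om b y *: J b y.
  by move=> Uy; apply: (@span3_coord _ (J^~ y)); [exact: J_triple|exact: covEnd_unit_span].
have dJ b : is_derive x u (J b) ('D_u (J b) x).
  by apply: derivableP; apply: smooth_derivable (J_smooth b) Ux.
have dom b : exists d, is_derive x u (om b) d.
  have H := is_derive_trace (is_derive_mulmx (dJ b)
    (is_derive_covEnd nabla hc u v U_img (J_smooth a) Ux)).
  by have := is_deriveZ (- 4^-1) H => H'; eexists; exact: H'.
have [d dP] := choice dom.
rewrite covEndE E //.
have -> : 'D_u (fun y => covEnd nabla c (J a) y v) x =
   \sum_(b < 3) (d b *: J b x + om b x *: 'D_u (J b) x).
  have [_ <-] := is_derive_bigsum (index_enum 'I_3) (fun b => is_derive_scale (dP b) (dJ b)).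
  by apply: near_eq_derive; apply: (near_open U_open Ux).
rewrite mulmx_sumr mulmx_suml -sumrN -!big_split /=; apply: span3_sum => b.
rewrite -scalemxAr -scalemxAl -scalerN -!addrA -!scalerDr; apply: span3D.
  by apply/span3Z; exact: (@span3_gen _ (J^~ x)).
by apply: span3Z; rewrite addrA -covEndE; exact: covEnd_unit_span.
Qed.

Lemma qkt_curvature_span x a u v : U x ->
  span3 (J ^~ x) (J a x *m curv_mx nabla c x u v - curv_mx nabla c x u v *m J a x).
Proof.
move=> Ux; rewrite -opprB -(ricci_identity _ hc _ _ U_open U_img) // opprB.
rewrite -scaleN1r; apply: span3D; first exact: covEnd2_unit_span.
by apply: span3Z; exact: covEnd2_unit_span.
Qed.

(** Both connections induce the same connection on the quaternionic bundle, hence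
    have the same curvature there. *)
Lemma weyl_qkt_curvature x a u v : U x ->
  J a x *m curv_mx W c x u v - curv_mx W c x u v *m J a x =
  J a x *m curv_mx nabla c x u v - curv_mx nabla c x u v *m J a x.
Proof.
move=> Ux; apply: oppr_inj; rewrite !opprB.
rewrite -!(ricci_identity _ hc _ _ U_open U_img (J_smooth a) Ux).
have E p r : covEnd W c (fun y => covEnd W c (J a) y p) x r =
    covEnd nabla c (fun y => covEnd nabla c (J a) y p) x r.
  have gen y : span3 (J^~ y) (J a y) by exact: (@span3_gen _ (J^~ y)).
  transitivity (covEnd W c (fun y => covEnd nabla c (J a) y p) x r).
    by apply: (@covEnd_local _ _ W c U _ _ x r U_open Ux) => y Uy; exact: covEnd_weyl (gen y).
  by apply: covEnd_weyl => //; exact: covEnd_unit_span.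
by rewrite !E.
Qed.

Lemma ricci_form_weyl x e u v a : U x -> orthonormal g c x e ->
  ricci_form g nabla c (J a x) e x u v = half_trace (curv_mx W c x) (J a x) u v.
Proof.
move=> Ux He; have hx := U_img Ux.
have Gs := gram_sym g hc hx.
have q := quaternionic_triple_qtriple (J_triple Ux).
have Ja2 : J a x *m J a x = - 1%:M by case: (J_triple Ux).
have trE : \tr (J a x *m curv_mx W c x u v) = \tr (J a x *m curv_mx nabla c x u v).
  have q1 := qtriple_rot q; have q2 := qtriple_rot q1.
  move: a {Ja2}; apply: forall3.
  - exact: tr_commuting q (weyl_qkt_curvature 1 u v Ux).
  - exact: tr_commuting q1 (weyl_qkt_curvature 2 u v Ux).
  - exact: tr_commuting q2 (weyl_qkt_curvature 0 u v Ux).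
rewrite /half_trace trE -(orthonormal_trace Gs _ He) /ricci_form mulNr -mulrN -sumrN.
congr (_ * _); apply: eq_bigr => i _; rewrite curvatureE // -mulmxA.
have orth z w : dot (gram g c x) (J a x *m z) (J a x *m w) = dot (gram g c x) z w.
  exact: admissible_orthogonal.
by rewrite (dot_skew_unit _ _ Ja2 orth) opprK.
Qed.

(** The symmetric parts of [K] and of the Ricci tensor of the Weyl connection are
    opposite to each other. *)
Lemma sym_Ktensor_weyl x e u v : U x -> orthonormal g c x e ->
  Sym (Ktensor g nabla c (J ^~ x) e x) u v = - Sym (ricci W c x) u v.
Proof.
move=> Ux He; have hx := U_img Ux; case: hW => tf _.
have q := quaternionic_triple_qtriple (J_triple Ux).
have q1 := qtriple_rot q; have q2 := qtriple_rot q1.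
have com a p r : exists k1 k2 k3, J a x *m curv_mx W c x p r - curv_mx W c x p r *m J a x =
    k1 *: J 0 x + k2 *: J 1 x + k3 *: J 2 x.
  rewrite weyl_qkt_curvature //; have [k ->] := qkt_curvature_span a p r Ux.
  by exists (k 0), (k 1), (k 2); rewrite sum3.
have KE p r : Ktensor g nabla c (J ^~ x) e x p r =
    half_trace (curv_mx W c x) (J 0 x) p (J 0 x *m r)
  + half_trace (curv_mx W c x) (J 1 x) p (J 1 x *m r)
  + half_trace (curv_mx W c x) (J 2 x) p (J 2 x *m r).
  by rewrite /Ktensor sum3 !ricci_form_weyl.
have RE p r : ricci W c x p r = trace_ric (curv_mx W c x) p r by exact: ricciE.
have H := @sym_half_trace_ric R (curv_mx W c x) (fun u => curv_mx_linear W hc u hx)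
  (curv_mx_skew W c x)
  (fun u v w => torsion_free_bianchi hc u v w hx tf)
  (J 0 x) (J 1 x) (J 2 x) u v q.
move: H; rewrite /Sym !KE !RE; apply => p r.
- by have [k1 [k2 [k3 E]]] := com 0 p r; exact: qtriple_commutator q E.
- have [k1 [k2 [k3 E]]] := com 1 p r.
  by apply: (qtriple_commutator (a := k2) (b := k3) (c := k1) q1); rewrite E -addrA addrC.
- have [k1 [k2 [k3 E]]] := com 2 p r.
  by apply: (qtriple_commutator (a := k3) (b := k1) (c := k2) q2); rewrite E addrC addrA.
Qed.

Lemma orthonormal_exists x : U x -> exists e, orthonormal g c x e.
Proof.
move=> Ux; have hx := U_img Ux.
have q := quaternionic_triple_qtriple (J_triple Ux).
have u0 : (delta_mx 0 0 : coord R) != 0.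
  by apply/eqP => /matrixP /(_ 0 0); rewrite !mxE /= => /eqP; rewrite oner_eq0.
eexists; apply: (quat_frame_orthonormal (gram_sym g hc hx) _ q _ _ _ u0).
- by move=> u; exact: gram_pos.
- by move=> u v; exact: admissible_orthogonal.
- by move=> u v; exact: admissible_orthogonal.
- by move=> u v; exact: admissible_orthogonal.
Qed.

End weyl_and_qkt.

(** * The equivalence *)

Theorem theorem5p8 (R : realType) (M : manifold4 R)
    (Q : almost_quaternionic M) (g : riem_metric M) (nabla : connection M)
    (t : oneform M) (W : connection M)
    (hQKT : QKT Q g nabla)
    (ht : is_torsion_oneform Q g nabla t)
    (hW : is_weyl g t W) :
  sp1_einstein Q g nabla <-> einstein_weyl g W.
Proof.
split=> [einK|[f einR] c U J hc hJ x e Ux He u v].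
- (* The factor at a point, chosen among the values found in the charts there.  *)
  pose P p := [set l : R | exists c x, [/\ atlas c, img c x, psi c x = p &
    forall u v, Sym (ricci W c x) u v = l * gdot g c x u v]].
  exists (fun p => xget 0 (P p)) => c x hc hx u v.
  have [U [J [Ux hJ]]] := fiber_local Q hc hx.
  have [e He] := orthonormal_exists hQKT hc hJ Ux.
  have Hl z w : Sym (ricci W c x) z w =
      - ((\sum_(i < 4) Ktensor g nabla c (J ^~ x) e x (e i) (e i)) / 4) * gdot g c x z w.
    have := einK c U J hc hJ x e Ux He z w; rewrite /=.
    by rewrite (sym_Ktensor_weyl hQKT ht hW hc hJ _ _ Ux He) mulNr => <-; rewrite opprK.
  have [|d [y [hd hy yx Hl']]] := @xgetPex _ 0 (P (psi c x)).
    by eexists; exists c, x; split => //; exact: Hl.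
  by rewrite Hl (einstein_factor_unique hc hd hx hy (esym yx) Hl Hl').
have hx : img c x by case: hJ => _ H _ _; exact: H.
have E z w : Sym (Ktensor g nabla c (J ^~ x) e x) z w = - f (psi c x) * gdot g c x z w.
  by rewrite (sym_Ktensor_weyl hQKT ht hW hc hJ _ _ Ux He) einR // mulNr.
rewrite /= E; congr (_ * _).
have K i : Ktensor g nabla c (J ^~ x) e x (e i) (e i) = - f (psi c x).
  have := E (e i) (e i); rewrite He eqxx mulr1 /Sym => <-.
  move: (Ktensor _ _ _ _ _ _ _ _) => k; by field.
rewrite (eq_bigr _ (fun i _ => K i)) big_const_ord iter_addr_0; by field.
Qed.
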